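(* Let $\sigma\in C(\mathbb{R})$ be not a polynomial, let $\mathbf{a}^1,\mathbf{a}^2\in\mathbb{R}^d\setminus\{\mathbf{0}\}$ be fixed vectors, and let $W_1=\{t_1\mathbf{a}^1,t_2\mathbf{a}^2:\ t_1,t_2\in\mathbb{R}\}$ (the union of the two lines spanned by $\mathbf{a}^1$ and $\mathbf{a}^2$) be the set of weights. Let $X$ be a compact subset of $\mathbb{R}^d$ all of whose orbits are closed. Then $\mathcal{M}_X(\sigma;W_1,\mathbb{R})$ is dense in $C(X)$ if and only if $X$ contains no closed paths with respect to the directions $\mathbf{a}^1$ and $\mathbf{a}^2$.
   Context: $C(X)$ is the space of real continuous functions on $X$ with the uniform norm. $\mathcal{M}_X(\sigma;W_1,\mathbb{R})$ is the set of restrictions to $X$ of functions in $\mathrm{span}\{\sigma(\mathbf{w}\cdot\mathbf{x}-\theta):\mathbf{w}\in W_1,\ \theta\in\mathbb{R}\}$. A path with respect to $\mathbf{a}^1,\mathbf{a}^2$ in $X$ is an ordered sequence $(\mathbf{p}_1,\mathbf{p}_2,\dots)$ (finite or infinite) of points of $X$ with $\mathbf{p}_i\ne\mathbf{p}_{i+1}$ and either $\mathbf{a}^1\cdot\mathbf{p}_1=\mathbf{a}^1\cdot\mathbf{p}_2,\ \mathbf{a}^2\cdot\mathbf{p}_2=\mathbf{a}^2\cdot\mathbf{p}_3,\ \mathbf{a}^1\cdot\mathbf{p}_3=\mathbf{a}^1\cdot\mathbf{p}_4,\dots$ or $\mathbf{a}^2\cdot\mathbf{p}_1=\mathbf{a}^2\cdot\mathbf{p}_2,\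 \mathbf{a}^1\cdot\mathbf{p}_2=\mathbf{a}^1\cdot\mathbf{p}_3,\ \mathbf{a}^2\cdot\mathbf{p}_3=\mathbf{a}^2\cdot\mathbf{p}_4,\dots$; a single point is a path. A finite path $(\mathbf{p}_1,\dots,\mathbf{p}_{2n})$ is closed if $(\mathbf{p}_1,\dots,\mathbf{p}_{2n},\mathbf{p}_1)$ is a path. The relation on $X$ given by $\mathbf{x}\sim\mathbf{y}$ if $\mathbf{x}$ and $\mathbf{y}$ belong to some path in $X$ is an equivalence relation, and its equivalence classes are called orbits; ''all orbits closed'' means each orbit is a topologically closed set. *)

(* Defs.v *)
From HB Require Import structures.
From mathcomp Require Import all_boot all_order all_algebra.
From mathcomp Require Import all_classical all_reals all_analysis.
Import Order.TTheory GRing.Theory Num.Theory.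
Import numFieldNormedType.Exports.
Set Implicit Arguments.
Unset Strict Implicit.
Unset Printing Implicit Defensive.
Local Open Scope classical_set_scope.
Local Open Scope ring_scope.

Definition dotv (R : realType) (d : nat) (a x : 'rV[R]_d) : R :=
  \sum_(i < d) a 0 i * x 0 i.

(* A finite or infinite sequence is given by its length [N] ([Some n] for n
   terms, [None] for infinitely many) and a function [p] on indices, numbered
   from 0; the values of [p] at indices outside the range are irrelevant. *)
Definition in_range (N : option nat) (i : nat) : bool :=
  if N is Some n then (i < n)%N else true.

Section Paths.
Variables (R : realType) (d : nat).
Implicit Types (a b x y : 'rV[R]_d) (X : set 'rV[R]_d) (p : nat -> 'rV[R]_d).

Definition alternates a b (N : option nat) p : Prop :=
  forall i, in_range N i.+1 ->
    let c := if odd i then b else a in dotv c (p i) = dotv c (p i.+1).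

Definition is_path a1 a2 X (N : option nat) p : Prop :=
  [/\ in_range N 0,
      forall i, in_range N i -> X (p i),
      forall i, in_range N i.+1 -> p i <> p i.+1
    & alternates a1 a2 N p \/ alternates a2 a1 N p].

(* Appending the first point is done by reading indices modulo the length. *)
Definition is_closed_path a1 a2 X (n : nat) p : Prop :=
  is_path a1 a2 X (Some n.*2) p /\
  is_path a1 a2 X (Some n.*2.+1) (fun i => p (i %% n.*2)%N).

Definition has_closed_path a1 a2 X : Prop :=
  exists n p, is_closed_path a1 a2 X n p.

Definition path_equiv a1 a2 X x y : Prop :=
  exists N p, is_path a1 a2 X N p /\
    (exists2 i, in_range N i & p i = x) /\ (exists2 j, in_range N j & p j = y).

Definition path_orbit a1 a2 X x : set 'rV[R]_d := [set y | path_equiv a1 a2 X x y].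

End Paths.

Definition two_lines (R : realType) (d : nat) (a1 a2 : 'rV[R]_d) :
    set 'rV[R]_d :=
  range (fun t : R => t *: a1) `|` range (fun t : R => t *: a2).

Definition ridge_span (R : realType) (d : nat) (sigma : R -> R)
    (W : set 'rV[R]_d) : set ('rV[R]_d -> R) :=
  [set h | exists (n : nat) (c : 'I_n -> R) (w : 'I_n -> 'rV[R]_d)
      (theta : 'I_n -> R), (forall k, W (w k)) /\
      h = (fun x => \sum_(k < n) c k * sigma (dotv (w k) x - theta k))].

(* A function on [X] is represented by any of its extensions to the whole
   space, so [CX X] and [MX sigma W X] are closed under changing values
   outside [X]. The topology of [{uniform` X -> R}] only sees values on [X];
   on [CX X] with [X] compact it is that of the uniform norm. *)
Definition CX (R : realType) (d : nat) (X : set 'rV[R]_d) :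
    set {uniform` X -> R} :=
  [set f : 'rV[R]_d -> R | {within X, continuous f}].
Arguments CX {R d} X _.

Definition MX (R : realType) (d : nat) (sigma : R -> R)
    (W X : set 'rV[R]_d) : set {uniform` X -> R} :=
  [set g : 'rV[R]_d -> R |
    exists2 h, ridge_span sigma W h & forall x, X x -> g x = h x].
Arguments MX {R d} sigma W X _.

Definition dense_in (T : topologicalType) (A B : set T) : Prop :=
  A `<=` B /\ B `<=` closure A.

(* Main.v *)
(* If [X] contains a closed path, a shortest one (in the number of lines used)
   carries an alternating sum of point evaluations that is non-zero on [C(X)]
   but kills every function of [a1 . x] and every function of [a2 . x].

   Conversely, suppose that the ridge functions are not dense.  By Hahn-Banach
   there are two positive functionals, i.e. two finite Borel measures on [X],
   that agree on them but not on some continuous function.  Since [sigma] is not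
   a polynomial, the closure of the ridge functions contains all powers of
   [a_i . x] (differentiate [sigma (t s + y)] in [t] at [t = 0]), so both measures
   have the same images under [a1 . x] and [a2 . x].  Without closed paths each
   orbit is a tree whose vertices are the lines of constant [a_i . x] and whose
   edges are its points.  An orbit is compact, so it has a leftmost line; root the
   tree there and let [D_n] be the set of points at distance [n] from the root.
   These sets are Borel, because [a1 . x] minimized over the points within [n]
   steps is lower semicontinuous.  On a line leaving a set [S] of points of [D_n]
   downwards, the remaining points lie in [D_(n+1)]; hence the difference [nu] of
   the two measures has at least as much mass on [D_(n+1)] as on [D_n].  The total
   mass being finite, [nu] vanishes on every [D_n], and thus [nu = 0]. *)
From HB Require Import structures.
Require Import Defs.
From mathcomp Require Import all_boot all_order all_algebra.
From mathcomp Require Import all_classical all_reals all_analysis.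
From mathcomp Require Import ring lra.
Import Order.TTheory GRing.Theory Num.Theory.
Import numFieldNormedType.Exports.
Set Implicit Arguments.
Unset Strict Implicit.
Unset Printing Implicit Defensive.
Local Open Scope classical_set_scope.
Local Open Scope ring_scope.

(** * Hahn-Banach for sublinear functionals *)

(** Since [sigma] is only continuous, it cannot be differentiated. Differences in the translation
    take over: [x ^+ m] times an [m]-th difference of [sigma] is a limit of ridge functions, and
    some [m]-th difference is non-zero because [sigma] is not a polynomial.

    An orbit may be an infinite tree without leaves from which mass could be cancelled; so mass is
    pushed away from the root, and finiteness of the total mass ends the argument. This asks for a
    root that depends measurably on the orbit, and closed orbits supply it as the minimum of
    [a1 . x]. It also asks for the union of the lines through a set to be Borel, which is clear for
    compact sets; hence the inner regularity and the small errors in the estimates of mass.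

    The two measures are compared with the functionals through inequalities on sets only; no
    integral against them is formed. *)

Section HahnBanach.
Variables (R : realType) (V : lmodType R) (E : set V).
Hypothesis ED : forall x y, E x -> E y -> E (x + y).
Hypothesis EZ : forall (c : R) x, E x -> E (c *: x).

Definition sublinear_on (p : V -> R) :=
  (forall x y, E x -> E y -> p (x + y) <= p x + p y) /\
  (forall c x, 0 <= c -> E x -> p (c *: x) <= c * p x).

Let EN x : E x -> E (- x).
Proof. by move=> Ex; rewrite -scaleN1r; exact: EZ. Qed.

Let sublinear0 p x : sublinear_on p -> E x -> p 0 = 0.
Proof.
move=> [pD pZ] Ex; have E0 : E 0 by rewrite -(scale0r x); exact: EZ.
apply/eqP; rewrite eq_le; apply/andP; split.
  by have := pZ 0 0 (lexx 0) E0; rewrite scale0r mul0r.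
by have := pD 0 0 E0 E0; rewrite addr0 -{1}[p 0]addr0 lerD2l.
Qed.

Let sublinear_opp p x : sublinear_on p -> E x -> - p (- x) <= p x.
Proof.
move=> sp Ex; have := sp.1 x (- x) Ex (EN Ex).
by rewrite subrr (sublinear0 sp Ex) -lerBlDr sub0r.
Qed.

Let sublinearZ p c x : sublinear_on p -> 0 <= c -> E x -> p (c *: x) = c * p x.
Proof.
move=> sp; rewrite le_eqVlt => /orP[/eqP<-|c0] Ex.
  by rewrite scale0r mul0r (sublinear0 sp Ex).
apply/eqP; rewrite eq_le; apply/andP; split; first by apply: sp.2 => //; exact: ltW.
rewrite -ler_pdivlMl//.
have := sp.2 c^-1 (c *: x); rewrite scalerA mulVf ?gt_eqF// scale1r; apply.
  by rewrite invr_ge0 ltW.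
exact: EZ.
Qed.

(* A sublinear functional that is not additive along [v] lies strictly above
   this one somewhere, so minimal sublinear functionals are linear. *)
Definition sublinear_lower (p : V -> R) (v w : V) : R :=
  inf [set p (w + t *: v) - t * p v | t in [set t | 0 <= t]].

Section Lower.
Variables (p : V -> R) (v : V).
Hypotheses (sp : sublinear_on p) (Ev : E v).

Let lower_has_inf w : E w ->
  has_inf [set p (w + t *: v) - t * p v | t in [set t | 0 <= t]].
Proof.
move=> Ew; split; first by exists (p (w + 0 *: v) - 0 * p v), 0 => /=.
exists (- p (- w)) => _ [t /= t0 <-].
have Etv := EZ t Ev.
have := sp.1 _ _ (ED Ew Etv) (EN Ew).
by rewrite (addrC w) addrK (sublinearZ sp t0 Ev); lra.
Qed.

Lemma sublinear_lower_le w t : E w -> 0 <= t ->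
  sublinear_lower p v w <= p (w + t *: v) - t * p v.
Proof.
by move=> Ew t0; apply: ge_inf; [have [] := lower_has_inf Ew|exists t].
Qed.

Lemma sublinear_lower_ge w m : E w ->
  (forall t, 0 <= t -> m <= p (w + t *: v) - t * p v) -> m <= sublinear_lower p v w.
Proof.
move=> Ew mw; apply: lb_le_inf; first by have [] := lower_has_inf Ew.
by move=> _ [t t0 <-]; exact: mw.
Qed.

Lemma sublinear_lower_sublinear : sublinear_on (sublinear_lower p v).
Proof.
split=> [x y Ex Ey|c x c0 Ex].
  rewrite -lerBlDr; apply: sublinear_lower_ge => // s s0.
  rewrite lerBlDl -lerBlDr; apply: sublinear_lower_ge => // t t0.
  rewrite lerBlDr (le_trans (sublinear_lower_le (ED Ex Ey) (addr_ge0 s0 t0)))//.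
  have := sp.1 _ _ (ED Ex (EZ s Ev)) (ED Ey (EZ t Ev)).
  by rewrite addrACA scalerDl; lra.
move: c0; rewrite le_eqVlt => /orP[/eqP<-|c0].
  rewrite scale0r mul0r.
  have E0 : E 0 by rewrite -(scale0r x); exact: EZ.
  rewrite (le_trans (sublinear_lower_le E0 (lexx 0)))//.
  by rewrite scale0r addr0 mul0r subr0 (sublinear0 sp Ex).
rewrite -ler_pdivrMl//; apply: sublinear_lower_ge => // t t0.
rewrite ler_pdivrMl//.
rewrite (le_trans (sublinear_lower_le (EZ c Ex) (mulr_ge0 (ltW c0) t0)))//.
rewrite -scalerA -scalerDr (sublinearZ sp (ltW c0)); last exact: ED (EZ _ _).
by rewrite -mulrA -mulrBr.
Qed.

Lemma sublinear_lower_le_self w : E w -> sublinear_lower p v w <= p w.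
Proof.
move=> Ew; have := sublinear_lower_le Ew (lexx 0).
by rewrite scale0r addr0 mul0r subr0.
Qed.

Lemma sublinear_lower_le_add w : E w -> sublinear_lower p v w <= p (w + v) - p v.
Proof. by move=> Ew; have := sublinear_lower_le Ew ler01; rewrite scale1r mul1r. Qed.

End Lower.

(** Zorn's lemma for the reversed pointwise order. The lower bound of a chain is its pointwise
    infimum: finite because [- q (- x) <= p x], and subadditive because the smaller of two members
    of the chain serves for both arguments. *)
Lemma minimal_sublinear (q : V -> R) : sublinear_on q ->
  exists p, [/\ sublinear_on p, forall x, E x -> p x <= q x
   & forall p', sublinear_on p' -> (forall x, E x -> p' x <= p x) ->
       forall x, E x -> p x <= p' x].
Proof.
move=> sq; pose S := {p : V -> R | sublinear_on p /\ forall x, E x -> p x <= q x}.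
pose le_S (p p' : S) := `[< forall x, E x -> sval p' x <= sval p x >].
pose q0 : S := exist _ q (conj sq (fun x _ => lexx (q x))).
have [||A totA|[p [sp pq]] pmin] := @ZL_preorder S q0 le_S.
- by move=> p; apply/asboolP.
- move=> p1 p2 p3 /asboolP p12 /asboolP p23; apply/asboolP => x Ex.
  exact: le_trans (p23 x Ex) (p12 x Ex).
- have [->|/set0P[p0 Ap0]] := eqVneq A set0; first by exists q0.
  pose F x := [set sval p x | p in A].
  have infF x : E x -> has_inf (F x).
    move=> Ex; split; first by exists (sval p0 x), p0.
    exists (- q (- x)) => _ [p Ap <-].
    have [sp pq] := svalP p.
    by rewrite (le_trans _ (sublinear_opp sp Ex))// lerN2 pq//; exact: EN.
  have infP x p : E x -> A p -> inf (F x) <= sval p x.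
    by move=> Ex Ap; apply: ge_inf; [have [] := infF x Ex|exists p].
  have infG x m : E x -> (forall p, A p -> m <= sval p x) -> m <= inf (F x).
    move=> Ex mA; apply: lb_le_inf; first by have [] := infF x Ex.
    by move=> _ [p Ap <-]; exact: mA.
  have sinf : sublinear_on (fun x => inf (F x)).
    split=> [x y Ex Ey|c x c0 Ex].
      rewrite -lerBlDr; apply: (infG) => // p1 Ap1.
      rewrite lerBlDl -lerBlDr; apply: (infG) => // p2 Ap2; rewrite lerBlDr.
      have [/asboolP p12|/asboolP p21] := totA p1 p2 Ap1 Ap2.
        rewrite (le_trans (infP _ _ (ED Ex Ey) Ap2))//.
        by rewrite (le_trans ((svalP p2).1.1 _ _ Ex Ey))// addrC lerD2l p12.
      rewrite (le_trans (infP _ _ (ED Ex Ey) Ap1))//.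
      by rewrite (le_trans ((svalP p1).1.1 _ _ Ex Ey))// addrC lerD2r p21.
    move: c0; rewrite le_eqVlt => /orP[/eqP<-|c0].
      rewrite mul0r scale0r; have E0 : E 0 by rewrite -(scale0r x); exact: EZ.
      by rewrite (le_trans (infP _ _ E0 Ap0))// (sublinear0 (svalP p0).1 Ex).
    rewrite -ler_pdivrMl//; apply: (infG) => // p Ap; rewrite ler_pdivrMl//.
    by rewrite (le_trans (infP _ _ (EZ c Ex) Ap))// (svalP p).1.2 ?ltW.
  have infq x : E x -> inf (F x) <= q x.
    by move=> Ex; rewrite (le_trans (infP x p0 Ex Ap0))// (svalP p0).2.
  pose pinf : S := exist (fun p => sublinear_on p /\ forall x, E x -> p x <= q x) (fun x => inf (F x)) (conj sinf infq).
  exists pinf => p Ap; apply/asboolP => x Ex /=.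
  exact: infP.
- exists p; split => // p' sp' p'p x Ex.
  have p'q y : E y -> p' y <= q y by move=> Ey; exact: le_trans (p'p y Ey) (pq y Ey).
  have /asboolP := pmin (exist _ p' (conj sp' p'q)) (asboolT p'p).
  exact.
Qed.

(** The minimal functional is taken below [sublinear_lower q v0] instead of [q]: at [- v0] this
    gives [l (- v0) <= - q v0], the missing half of [l v0 = q v0]. Additivity is minimality compared
    with [sublinear_lower l y]. *)
Theorem hahn_banach_sublinear (q : V -> R) (v0 : V) : sublinear_on q -> E v0 ->
  exists l : V -> R, [/\ forall x y, E x -> E y -> l (x + y) = l x + l y,
    forall c x, E x -> l (c *: x) = c * l x, forall x, E x -> l x <= q x
  & l v0 = q v0].
Proof.
move=> sq Ev0.
have [l [sl lq0 lmin]] := minimal_sublinear (sublinear_lower_sublinear sq Ev0).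
have lq x : E x -> l x <= q x.
  by move=> Ex; rewrite (le_trans (lq0 x Ex))// sublinear_lower_le_self.
have lD x y : E x -> E y -> l (x + y) = l x + l y.
  move=> Ex Ey; apply/eqP; rewrite eq_le; apply/andP; split; first exact: sl.1.
  rewrite -lerBrDr.
  have := lmin _ (sublinear_lower_sublinear sl Ey).
  move=> /(_ (sublinear_lower_le_self sl Ey) x Ex)/le_trans; apply.
  exact: sublinear_lower_le_add.
have lN x : E x -> l (- x) = - l x.
  move=> Ex; apply/eqP; rewrite -addr_eq0 addrC -lD ?subrr//; last exact: EN.
  by rewrite (sublinear0 sl Ex).
exists l; split => // [c x Ex|].
  have [c0|c0] := leP 0 c; first exact: sublinearZ.
  rewrite -[c *: x]opprK -scaleNr lN; last exact: EZ.
  by rewrite (sublinearZ sl) ?oppr_ge0 ?ltW// mulNr opprK.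
apply/eqP; rewrite eq_le lq//= -lerN2 -lN//.
rewrite (le_trans (lq0 _ (EN Ev0)))//.
rewrite (le_trans (sublinear_lower_le_add sq Ev0 (EN Ev0)))//.
by rewrite addNr (sublinear0 sq Ev0) sub0r.
Qed.

End HahnBanach.

(** A total map on functions, constrained only at continuous ones. Testing positivity on [X] alone
    makes its value depend only on the restriction to [X]. *)
Definition positive_functional (R : realType) (T : topologicalType) (X : set T)
    (P : (T -> R) -> R) :=
  [/\ forall f g : T -> R, continuous f -> continuous g ->
        P (fun x => f x + g x) = P f + P g,
      forall (c : R) (f : T -> R), continuous f -> P (fun x => c * f x) = c * P f
    & forall f : T -> R, continuous f -> (forall x, X x -> 0 <= f x) -> 0 <= P f].

(** * Separation from a subspace by two positive functionals *)

Section Separation.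
Variables (R : realType) (T : topologicalType) (X : set T) (S : set (T -> R)).
Hypothesis cX : compact X.
Hypothesis Sc : forall s, S s -> continuous s.
Hypothesis SD : forall s t, S s -> S t -> S (fun x => s x + t x).
Hypothesis SZ : forall c s, S s -> S (fun x => c * s x).
Hypothesis S0 : S (fun=> 0).

Let V := ((T -> R^o) * (T -> R^o))%type.

Let E : set V := [set g | continuous (g.1 : T -> R) /\ continuous (g.2 : T -> R)].

Let ED (g h : V) : E g -> E h -> E (g + h).
Proof.
move=> [g1 g2] [h1 h2]; split => x; apply: cvgD;
  [exact: g1|exact: h1|exact: g2|exact: h2].
Qed.

Let EZ (c : R) (g : V) : E g -> E (c *: g).
Proof.
by move=> [g1 g2]; split => x; apply: cvgM;
  [exact: cvg_cst|exact: g1|exact: cvg_cst|exact: g2].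
Qed.

Let gap (g : V) (M : R) := exists2 s, S s &
  forall x, X x -> g.1 x - s x <= M /\ g.2 x + s x <= M.

Let q (g : V) : R := inf [set M | gap g M].

Let bounded_above (g : T -> R) : continuous g ->
  exists M, forall x, X x -> g x <= M.
Proof.
move=> cg; have [X0|/set0P X0] := eqVneq X set0.
  by exists 0 => x; rewrite X0.
have [c _ cm] := compact_EVT_max X0 cX (continuous_subspaceT cg).
by exists (g c) => x Xx; apply: cm; rewrite inE.
Qed.

Let has_inf_gap (g : V) : X !=set0 -> E g -> has_inf [set M | gap g M].
Proof.
move=> [x0 Xx0] [g1 g2]; split.
  have [M1 gM1] := bounded_above g1; have [M2 gM2] := bounded_above g2.
  exists (Num.max M1 M2), (fun=> 0) => // x Xx.
  by rewrite subr0 addr0 !le_max gM1// gM2// orbT.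
exists ((g.1 x0 + g.2 x0) / 2) => M [s _ /(_ x0 Xx0)]; lra.
Qed.

Let gap_le g M : X !=set0 -> E g -> gap g M -> q g <= M.
Proof.
by move=> X0 Eg gM; apply: ge_inf => //; have [] := has_inf_gap X0 Eg.
Qed.

Let gap_ge g m : X !=set0 -> E g -> (forall M, gap g M -> m <= M) -> m <= q g.
Proof.
by move=> X0 Eg gm; apply: lb_le_inf => //; have [] := has_inf_gap X0 Eg.
Qed.

Let q_sublinear : X !=set0 -> sublinear_on E q.
Proof.
move=> X0; split=> [g h Eg Eh|c g c0 Eg].
  rewrite -lerBlDr; apply: gap_ge => // M [s Ss gs].
  rewrite lerBlDr -lerBlDl; apply: gap_ge => // N [t St ht].
  rewrite lerBlDl; apply: gap_le => //; first exact: ED.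
  exists (fun x => s x + t x) => [|x Xx]; first exact: SD.
  have [? ?] := gs x Xx; have [? ?] := ht x Xx.
  by rewrite /= !fctE; split; lra.
move: c0; rewrite le_eqVlt => /orP[/eqP<-|c0].
  rewrite mul0r; apply: gap_le => //; first exact: EZ.
  by exists (fun=> 0) => // x Xx; rewrite /= !fctE !scale0r subr0 addr0.
rewrite -ler_pdivrMl//; apply: gap_ge => // M [s Ss gs].
rewrite ler_pdivrMl//; apply: gap_le => //; first exact: EZ.
exists (fun x => c * s x) => [|x Xx]; first exact: SZ.
have [? ?] := gs x Xx.
change (c * g.1 x - c * s x <= c * M /\ c * g.2 x + c * s x <= c * M).
by rewrite -mulrBr -mulrDr !ler_pM2l.
Qed.

(* Hahn-Banach on pairs [(g, h)], for the least common bound of [g - s] and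
   [h + s], produces the two functionals at once. *)
Theorem separating_functionals (f : T -> R) (e : R) : continuous f -> 0 < e ->
  (forall s, S s -> exists2 x, X x & e <= `|f x - s x|) ->
  exists P Q, [/\ positive_functional X P, positive_functional X Q,
    forall s, S s -> P s = Q s & Q f < P f].
Proof.
move=> cf e0 fS; have X0 : X !=set0 by have [x Xx _] := fS _ S0; exists x.
(* For this pair a common bound [M] means [|f - s| <= M] on [X], so [q v0] is the uniform distance
   from [f] to [S]. *)
pose v0 : V := (f, fun x => - f x).
have c0 : continuous (fun _ : T => 0 : R) by move=> x; exact: cvg_cst.
have cN (g : T -> R) : continuous g -> continuous (fun x => - g x).
  by move=> cg x; apply: cvgN; exact: cg.
have Ev0 : E v0 by split => //=; exact: cN.
have [l [lD lZ lq lv0]] := hahn_banach_sublinear ED EZ (q_sublinear X0) Ev0.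
have El (g : T -> R) : continuous g -> E (g, fun=> 0) by [].
have Er (g : T -> R) : continuous g -> E (fun=> 0, g) by [].
have l0 (g : V) M : E g -> gap g M -> l g <= M.
  by move=> Eg gM; rewrite (le_trans (lq g Eg))// gap_le.
have lN (g : V) : E g -> l (- g) = - l g by move=> Eg; rewrite -scaleN1r lZ// mulN1r.
have lPQ (g h : T -> R) : continuous g -> continuous h ->
    l (g, h) = l (g, fun=> 0) + l (fun=> 0, h).
  move=> cg ch; rewrite -lD//; congr l; congr pair; apply/funext => x /=.
    by rewrite !fctE addr0.
  by rewrite !fctE add0r.
have v0e : e <= l v0.
  rewrite lv0; apply: gap_ge => // M [s Ss sM]; have [x Xx] := fS s Ss.
  by have [/= + +] := sM x Xx; case: (ger0P (f x - s x)) => *; lra.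
exists (fun g => l (g, fun=> 0)), (fun g => l (fun=> 0, g)); split.
- split=> [g h cg ch|c g cg|g cg g0].
  + rewrite -lD//; congr l; congr pair; apply/funext => x //=.
    by rewrite !fctE addr0.
  + rewrite -lZ//; congr l; congr pair; apply/funext => x //=.
    by rewrite !fctE scaler0.
  + rewrite -oppr_le0 -lN//; apply: l0; first by split => //=; exact: cN.
    exists (fun=> 0) => // x Xx /=; rewrite !fctE subr0 addr0 oppr0 lexx oppr_le0.
    by split => //; exact: g0.
- split=> [g h cg ch|c g cg|g cg g0].
  + rewrite -lD//; congr l; congr pair; apply/funext => x //=.
    by rewrite !fctE addr0.
  + rewrite -lZ//; congr l; congr pair; apply/funext => x //=.
    by rewrite !fctE scaler0.
  + rewrite -oppr_le0 -lN//; apply: l0; first by split => //=; exact: cN.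
    exists (fun=> 0) => // x Xx /=; rewrite !fctE subr0 addr0 oppr0 lexx oppr_le0.
    by split => //; exact: g0.
- move=> s Ss; have cs := Sc Ss.
  (* This pair and its opposite both admit the common bound 0, through [s] and [- s]
     respectively. *)
  suff H : l (s, fun x => - s x) = 0.
    apply/eqP; rewrite -subr_eq0 -lN//; apply/eqP; rewrite -[RHS]H (lPQ s (fun x => - s x))//; last exact: cN.
    congr (_ + l _); congr pair; apply/funext => x //=.
    by rewrite !fctE oppr0.
  have Es : E (s, fun x => - s x) by split => //=; exact: cN.
  apply/eqP; rewrite eq_le; apply/andP; split.
    by apply: l0 => //; exists s => // x Xx /=; rewrite subrr addNr.
  rewrite -oppr_le0 -lN//; apply: l0; first by rewrite -scaleN1r; exact: EZ.
  exists (fun x => -1 * s x) => [|x Xx]; first exact: SZ.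
  by rewrite /= !fctE mulN1r opprK addNr subrr.
- rewrite -subr_gt0 (lt_le_trans e0)// (le_trans v0e)// /v0 (lPQ f (fun x => - f x))//; last exact: cN.
  rewrite -lN//.
  by rewrite le_eqVlt; apply/orP; left; apply/eqP; congr (_ + l _); congr pair;
    apply/funext => x //=; rewrite !fctE oppr0.
Qed.

End Separation.

(** * Positive functionals as Borel measures *)

Section DistanceToSet.
Variables (R : realType) (T : normedModType R) (A : set T).

Definition dist_to (z : T) : R := inf [set `|z - a| | a in A].

Lemma dist_to_ge0 z : 0 <= dist_to z.
Proof.
have [A0|/set0P[a Aa]] := eqVneq A set0; first by rewrite /dist_to A0 image_set0 inf0.
by apply: lb_le_inf => [|_ [b _ <-]//]; exists `|z - a|, a.
Qed.

Lemma dist_to_le z a : A a -> dist_to z <= `|z - a|.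
Proof.
move=> Aa; apply: ge_inf; last by exists a.
by exists 0 => _ [b _ <-].
Qed.

Lemma dist_to_lipschitz z w : A !=set0 -> dist_to z <= `|z - w| + dist_to w.
Proof.
move=> [a Aa]; rewrite -lerBlDl; apply: lb_le_inf; first by exists `|w - a|, a.
move=> _ [b Ab <-]; rewrite lerBlDl (le_trans (dist_to_le z Ab))//.
by rewrite -[z - b](subrKA w) ler_normD.
Qed.

Lemma dist_to_continuous : A !=set0 -> continuous dist_to.
Proof.
move=> A0 z; apply/cvgrPdist_le => e e0; near=> w.
have zw : `|z - w| <= e by near: w; apply: cvgr_dist_le => //; exact: cvg_id.
have := dist_to_lipschitz z w A0; have := dist_to_lipschitz w z A0.
rewrite (distrC w) ler_norml => *; apply/andP; split; lra.
Unshelve. all: by end_near. Qed.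

Lemma dist_to_gt0 z : A !=set0 -> closed A -> ~ A z -> 0 < dist_to z.
Proof.
move=> A0 cA Az.
have /nbhs_ballP[e /= e0 eA] : nbhs z (~` A).
  by apply: open_nbhs_nbhs; split => //; exact: closed_openC.
apply: (lt_le_trans e0); apply: lb_le_inf.
  by case: A0 => a Aa; exists `|z - a|, a.
move=> _ [b Ab <-]; rewrite leNgt; apply/negP => zb.
by apply: (eA b) => //; rewrite -ball_normE.
Qed.

End DistanceToSet.

Lemma open_cozero (R : realType) (T : normedModType R) (U : set T) : open U ->
  exists h : T -> R, [/\ continuous h, forall x, 0 <= h x, forall x, U x -> 0 < h x
    & forall x, ~ U x -> h x = 0].
Proof.
(* The infimum over an empty set is 0, so the distance to an empty complement would vanish
   everywhere; the constant 1 serves in that case. *)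
move=> oU; have [U0|/set0P U0] := eqVneq (~` U) set0.
  exists (fun=> 1); split => //; first by move=> x; exact: cvg_cst.
  by move=> x Ux; have : (~` U) x by []; rewrite U0.
exists (dist_to (~` U)); split.
- exact: dist_to_continuous.
- exact: dist_to_ge0.
- by move=> x Ux; apply: dist_to_gt0 => //; exact: open_closedC.
- move=> x Ux; apply/eqP; rewrite eq_le dist_to_ge0 andbT.
  by rewrite (le_trans (dist_to_le x (Ux : (~` U) x)))// subrr normr0.
Qed.

Lemma sum_continuous (R : realType) (T : topologicalType) (I : Type) (s : seq I)
    (F : I -> T -> R) : (forall i, continuous (F i)) ->
  continuous (fun x => \sum_(i <- s) F i x).
Proof.
move=> cF; elim: s => [|i s IH].
  rewrite (_ : (fun x => _) = fun=> 0); first by move=> x; exact: cvg_cst.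
  by apply/funext => x; rewrite big_nil.
rewrite (_ : (fun x => _) = fun x => F i x + \sum_(j <- s) F j x).
  by move=> x; apply: cvgD; [exact: cF|exact: IH].
by apply/funext => x; rewrite big_cons.
Qed.

Section PositiveFunctional.
Variables (R : realType) (T : normedModType R) (X : set T) (P : (T -> R) -> R).
Hypothesis cX : compact X.
Hypothesis PD : forall f g : T -> R, continuous f -> continuous g ->
  P (fun x => f x + g x) = P f + P g.
Hypothesis PZ : forall (c : R) (f : T -> R), continuous f ->
  P (fun x => c * f x) = c * P f.
Hypothesis P_ge0 : forall f : T -> R, continuous f ->
  (forall x, X x -> 0 <= f x) -> 0 <= P f.

Let ccst (c : R) : continuous (fun _ : T => c).
Proof. by move=> x; exact: cvg_cst. Qed.

Let cadd (f g : T -> R) : continuous f -> continuous g ->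
  continuous (fun x => f x + g x).
Proof. by move=> cf cg x; apply: cvgD; [exact: cf|exact: cg]. Qed.

Let cmul (f g : T -> R) : continuous f -> continuous g ->
  continuous (fun x => f x * g x).
Proof. by move=> cf cg x; apply: cvgM; [exact: cf|exact: cg]. Qed.

Let cscale (c : R) (f : T -> R) : continuous f -> continuous (fun x => c * f x).
Proof. by move=> cf; apply: cmul. Qed.

Let copp (f : T -> R) : continuous f -> continuous (fun x => - f x).
Proof. by move=> cf x; apply: cvgN; exact: cf. Qed.

Let cmin (f g : T -> R) : continuous f -> continuous g ->
  continuous (fun x => Num.min (f x) (g x)).
Proof. by move=> cf cg x; apply: continuous_min; [exact: cf|exact: cg]. Qed.

Lemma functionalB (f g : T -> R) : continuous f -> continuous g ->
  P (fun x => f x - g x) = P f - P g.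
Proof.
move=> cf cg; rewrite -mulN1r -PZ// -PD//; last exact: cscale.
by congr P; apply/funext => x; rewrite mulN1r.
Qed.

Lemma le_functional (f g : T -> R) : continuous f -> continuous g ->
  (forall x, X x -> f x <= g x) -> P f <= P g.
Proof.
move=> cf cg fg; rewrite -subr_ge0 -functionalB//; apply: P_ge0.
  by apply: cadd => //; exact: copp.
by move=> x Xx; rewrite subr_ge0 fg.
Qed.

Lemma functional_cst (c : R) : P (fun=> c) = c * P (fun=> 1).
Proof. by rewrite -PZ//; congr P; apply/funext => x; rewrite mulr1. Qed.

Lemma functional1_ge0 : 0 <= P (fun=> 1).
Proof. exact: P_ge0. Qed.

Lemma functional_sum (n : nat) (F : nat -> T -> R) : (forall i, continuous (F i)) ->
  P (fun x => \sum_(i < n) F i x) = \sum_(i < n) P (F i).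
Proof.
move=> cF; elim: n => [|n IHn].
  rewrite big_ord0 -[RHS](mul0r (P (fun=> 1))) -functional_cst; congr P.
  by apply/funext => x; rewrite big_ord0.
rewrite big_ord_recr/= -IHn -PD//; last exact: sum_continuous.
by congr P; apply/funext => x; rewrite big_ord_recr.
Qed.

(** Daniell's upper integral of the indicator of [A]: the supremum of the [G n] is a lower
    semicontinuous majorant. The strict [1 < G n x] makes the covered set open, and asking it only
    on [X] makes the complement of [X] null. *)
Definition fun_cover (A : set T) (M : R) := exists G : nat -> T -> R,
  [/\ forall n, continuous (G n), forall n x, 0 <= G n x,
      forall n x, G n x <= G n.+1 x, forall n, P (G n) <= M
    & forall x, A x -> X x -> exists n, 1 < G n x].

Definition outer_value (A : set T) : R := inf [set M | fun_cover A M].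

Let fun_cover_ge0 A M : fun_cover A M -> 0 <= M.
Proof.
move=> [G [cG G0 _ GM _]]; exact: le_trans (P_ge0 _ _) (GM 0%N).
Qed.

Let fun_cover_setT A : fun_cover A (2 * P (fun=> 1)).
Proof.
exists (fun _ _ => 2); split => //.
  by move=> _; rewrite functional_cst.
by move=> x _ _; exists 0%N; lra.
Qed.

Let has_inf_fun_cover A : has_inf [set M | fun_cover A M].
Proof.
split; first by exists (2 * P (fun=> 1)); exact: fun_cover_setT.
by exists 0 => M; exact: fun_cover_ge0.
Qed.

Lemma outer_value_le A M : fun_cover A M -> outer_value A <= M.
Proof. by move=> AM; apply: ge_inf => //; have [] := has_inf_fun_cover A. Qed.

Lemma outer_value_adherent A e : 0 < e ->
  exists2 M, fun_cover A M & M < outer_value A + e.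
Proof. by move=> e0; have [M ? ?] := inf_adherent e0 (has_inf_fun_cover A); exists M. Qed.

Lemma outer_value_ge0 A : 0 <= outer_value A.
Proof.
by apply: lb_le_inf; [have [] := has_inf_fun_cover A|move=> M; exact: fun_cover_ge0].
Qed.

Lemma outer_value_set0 : outer_value set0 = 0.
Proof.
apply/eqP; rewrite eq_le outer_value_ge0 andbT; apply: outer_value_le.
by exists (fun _ _ => 0); split => // _; rewrite functional_cst mul0r.
Qed.

Lemma le_outer_value A B : A `<=` B -> outer_value A <= outer_value B.
Proof.
move=> AB; apply/ler_addgt0Pr => e e0; have [M [G [? ? ? ? H]] MB] := outer_value_adherent B e0.
rewrite (le_trans _ (ltW MB))//; apply: outer_value_le.
by exists G; split => // x /AB; exact: H.
Qed.

Let incr_le (G : nat -> T -> R) : (forall n x, G n x <= G n.+1 x) ->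
  forall m n x, (m <= n)%N -> G m x <= G n x.
Proof.
move=> G1 m n x; elim: n => [|n IH]; first by rewrite leqn0 => /eqP ->.
rewrite leq_eqVlt => /orP[/eqP->//|/IH]; move=> /le_trans; exact.
Qed.

Let geo_sum (e : R) n : 0 <= e -> \sum_(i < n) e / 2 ^+ i.+1 <= e.
Proof.
move=> e0; suff -> : \sum_(i < n) e / 2 ^+ i.+1 = e - e / 2 ^+ n.
  by rewrite gerBl divr_ge0// exprn_ge0.
elim: n => [|n IH]; first by rewrite big_ord0 expr0 divr1 subrr.
rewrite big_ord_recr/= IH exprS; field; exact: expf_neq0.
Qed.

Lemma outer_value_sigma_subadditive :
  sigma_subadditive (fun A => (outer_value A)%:E).
Proof.
move=> F; have [->|] := eqVneq (\sum_(i <oo) (outer_value (F i))%:E)%E +oo%E.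
  exact: leey.
have s0 : (0 <= \sum_(i <oo) (outer_value (F i))%:E)%E.
  by apply: nneseries_ge0 => *; rewrite lee_fin outer_value_ge0.
rewrite -ltey -ge0_fin_numE// => sfin; rewrite -(fineK sfin) lee_fin.
set s := fine _; apply/ler_addgt0Pr => e e0; apply: outer_value_le.
have e2 i : 0 < e / 2 ^+ i.+1 by rewrite divr_gt0// exprn_gt0.
have /choice[M MF] i : exists M, fun_cover (F i) M /\
    M < outer_value (F i) + e / 2 ^+ i.+1.
  by have [M ? ?] := outer_value_adherent (F i) (e2 i); exists M.
have /choice[G GF] i : exists G : nat -> T -> R,
    [/\ forall n, continuous (G n), forall n x, 0 <= G n x,
      forall n x, G n x <= G n.+1 x, forall n, P (G n) <= M i
    & forall x, F i x -> X x -> exists n, 1 < G n x] := (MF i).1.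
exists (fun n x => \sum_(i < n) G i n x); split.
- by move=> n; apply: sum_continuous => i; have [] := GF i.
- by move=> n x; apply: sumr_ge0 => i _; have [_ +] := GF i; exact.
- move=> n x; rewrite big_ord_recr/= -[leLHS]addr0 lerD//.
    by apply: ler_sum => i _; have [_ _ +] := GF i; exact.
  by have [_ +] := GF n; exact.
- move=> n; rewrite (functional_sum _ (F := fun i => G i n)); last first.
    by move=> i; have [] := GF i.
  rewrite (@le_trans _ _ (\sum_(i < n) (outer_value (F i) + e / 2 ^+ i.+1)))//.
    apply: ler_sum => i _; rewrite (le_trans _ (ltW (MF i).2))//.
    by have [_ _ _ + _] := GF i; exact.
  rewrite big_split/= lerD//; last by rewrite geo_sum// ltW.
  rewrite -lee_fin fineK// -sumEFin -(big_mkord xpredT (fun i => (outer_value (F i))%:E)).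
  by apply: nneseries_lim_ge => *; rewrite lee_fin outer_value_ge0.
- move=> x [i _ Fix] Xx; have [_ Gi0 Gi1 _ /(_ x Fix Xx)[n n1]] := GF i.
  exists (maxn n i.+1); have im : (i < maxn n i.+1)%N by rewrite leq_maxr.
  rewrite (bigD1 (Ordinal im))//= (lt_le_trans n1)// -[leLHS]addr0 lerD//.
    by apply: incr_le => //; rewrite leq_maxl.
  by apply: sumr_ge0 => j _; have [_ +] := GF j; exact.
Qed.

Lemma dini (g : T -> R) (G : nat -> T -> R) : continuous g ->
  (forall n, continuous (G n)) -> (forall n x, G n x <= G n.+1 x) ->
  (forall x, X x -> exists n, g x < G n x) ->
  exists n, forall x, X x -> g x < G n x.
Proof.
move=> cg cG G1 gG.
have /compact_near_coveringP/(_ _ \oo (fun n x => g x < G n x) _) := cX.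
case=> [x Xx|N _ NX]; last by exists N => x Xx; apply: (NX N) => //=.
have [n gn] := gG x Xx.
have : \forall x' \near x, g x' < G n x'.
  have : (fun y => G n y - g y) y @[y --> x] --> G n x - g x.
    by apply: cvgB; [exact: cG|exact: cg].
  move=> /cvgr_gt/(_ 0); rewrite subr_gt0 => /(_ gn).
  by apply: filterS => y; rewrite subr_gt0.
move=> H; exists ([set y | g y < G n y], [set m | (n <= m)%N]).
  by split => //=; exists n.
move=> [y m] /= [gy nm]; exact: lt_le_trans gy (incr_le G1 _ nm).
Qed.

(** For a cover [G] of [A], each point of [X] satisfies [g < d + G n] for some [n]; Dini's theorem
    makes [n] uniform, and positivity gives [P g <= M + d * P 1]. The denominator of [d] contains
    [+ 1] because [P 1] may vanish. *)
Lemma functional_le_outer_value (A : set T) (g : T -> R) : continuous g ->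
  (forall x, X x -> A x -> g x <= 1) -> (forall x, X x -> ~ A x -> g x <= 0) ->
  P g <= outer_value A.
Proof.
move=> cg gA gNA; apply: lb_le_inf; first by have [] := has_inf_fun_cover A.
move=> M [G [cG G0 G1 GM GA]]; apply/ler_addgt0Pr => e e0.
pose d := e / (P (fun=> 1) + 1).
have P1 : 0 < P (fun=> 1) + 1 by rewrite ltr_wpDl// functional1_ge0.
have d0 : 0 < d by rewrite divr_gt0.
have [|||n gn] := @dini g (fun n x => d + G n x) cg.
- by move=> n; apply: cadd.
- by move=> n x; rewrite lerD2l.
- move=> x Xx; have [Ax|Ax] := pselect (A x).
    have [n n1] := GA x Ax Xx; exists n.
    by rewrite (le_lt_trans (gA x Xx Ax))// ltr_wpDl// ltW.
  by exists 0%N; rewrite (le_lt_trans (gNA x Xx Ax))// ltr_wpDr.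
rewrite (@le_trans _ _ (P (fun x => d + G n x)))//.
  by apply: le_functional => // [|x /gn/ltW//]; exact: cadd.
rewrite PD// functional_cst addrC lerD//.
rewrite /d -mulrA ger_pMr// mulrC ler_pdivrMr// mul1r.
by rewrite lerDl.
Qed.

Lemma outer_value_le_functional (A : set T) (g : T -> R) : continuous g ->
  (forall x, 0 <= g x) -> (forall x, X x -> A x -> 1 <= g x) ->
  outer_value A <= P g.
Proof.
move=> cg g0 gA; apply/ler_addgt0Pr => e e0.
have Pg0 : 0 <= P g by apply: P_ge0.
pose d := e / (P g + 1).
have d0 : 0 < d by rewrite divr_gt0// ltr_wpDl.
(* The factor [1 + d] turns [1 <= g] into the strict inequality of a cover. *)
apply: outer_value_le; exists (fun _ x => (1 + d) * g x); split => //.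
- by move=> _; exact: cscale.
- by move=> _ x; rewrite mulr_ge0// addr_ge0// ltW.
- move=> _; rewrite PZ// mulrDl mul1r lerD2l /d mulrAC ler_pdivrMr ?ltr_wpDl//.
  by rewrite mulrDr mulr1 lerDl ltW.
- move=> x Ax Xx; exists 0%N; have := gA x Xx Ax => g1.
  by rewrite (@lt_le_trans _ _ (1 + d))// ?ltrDl// ler_peMr// addr_ge0// ltW.
Qed.

(** A cover of [A] also covers the open set where it exceeds 1, so outer regularity is built into
    the definition. *)
Lemma outer_value_open (A : set T) (e : R) : 0 < e ->
  exists U, [/\ open U, A `<=` U & outer_value U <= outer_value A + e].
Proof.
move=> e0; have [M [G [cG G0 G1 GM GA]] MA] := outer_value_adherent A e0.
exists ((\bigcup_n [set x | 1 < G n x]) `|` ~` X); split.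
- apply: openU; last by apply: closed_openC; apply: compact_closed => //; exact: norm_hausdorff.
  apply: bigcup_open => n _; rewrite (_ : [set x | _] = G n @^-1` [set y | 1 < y])//.
  by apply: open_comp => // x _; exact: cG.
- move=> x Ax; have [Xx|Xx] := pselect (X x); last by right.
  by left; have [n n1] := GA x Ax Xx; exists n.
- rewrite (le_trans _ (ltW MA))//; apply: outer_value_le; exists G; split => //.
  by move=> x [[n _ n1] _|//]; exists n.
Qed.

(** A cover of [Z] splits into its products with [phi] and [1 - phi]. Bounding the sum at two
    independent indices lets [M] be divided into [sup S] and [M - sup S]. *)
Let outer_value_split (Z : set T) (phi : T -> R) : continuous phi ->
  (forall x, 0 <= phi x <= 1) ->
  outer_value (Z `&` [set x | phi x = 1]) + outer_value (Z `&` [set x | phi x = 0])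
    <= outer_value Z.
Proof.
move=> cphi phi01; apply: lb_le_inf; first by have [] := has_inf_fun_cover Z.
move=> M [G [cG G0 G1 GM GZ]].
have cGp n : continuous (fun x => G n x * phi x) by exact: cmul.
have cGq n : continuous (fun x => G n x * (1 - phi x)).
  by apply: cmul => //; apply: cadd => //; exact: copp.
have psi0 x : 0 <= 1 - phi x by rewrite subr_ge0; have /andP[] := phi01 x.
have phi0 x : 0 <= phi x by have /andP[] := phi01 x.
have bnd n m : P (fun x => G n x * phi x) <= M - P (fun x => G m x * (1 - phi x)).
  rewrite lerBrDr -PD//; apply: le_trans (GM (maxn n m)).
  apply: le_functional => //; first exact: cadd.
  move=> x _; have -> : G (maxn n m) x = G (maxn n m) x * phi x + G (maxn n m) x * (1 - phi x) by ring.
  apply: lerD.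
    by rewrite ler_wpM2r//; apply: incr_le => //; exact: leq_maxl.
  by rewrite ler_wpM2r//; apply: incr_le => //; exact: leq_maxr.
pose S := [set P (fun x => G n x * phi x) | n in [set: nat]].
have hS : has_sup S.
  split; first by exists (P (fun x => G 0%N x * phi x)), 0%N.
  by exists (M - P (fun x => G 0%N x * (1 - phi x))) => _ [n _ <-]; exact: bnd.
have <- : sup S + (M - sup S) = M by rewrite subrKC.
apply: lerD; apply: outer_value_le.
- exists (fun n x => G n x * phi x); split => //.
  + by move=> n x; rewrite mulr_ge0.
  + by move=> n x; rewrite ler_wpM2r.
  + by move=> n; apply: ub_le_sup; [case: hS|exists n].
  + by move=> x [Zx /= ->] Xx; have [n n1] := GZ x Zx Xx; exists n; rewrite mulr1.
- exists (fun n x => G n x * (1 - phi x)); split => //.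
  + by move=> n x; rewrite mulr_ge0.
  + by move=> n x; rewrite ler_wpM2r.
  + move=> m; rewrite lerBrDr addrC -lerBrDr; apply: ge_sup; first by case: hS.
    by move=> _ [n _ <-]; exact: bnd.
  + by move=> x [Zx /= ->] Xx; have [n n1] := GZ x Zx Xx; exists n; rewrite subr0 mulr1.
Qed.

Let oval (A : set T) : \bar R := (outer_value A)%:E.

Let oval0 : oval set0 = 0%E. Proof. by rewrite /oval outer_value_set0. Qed.

Let oval_ge0 A : (0 <= oval A)%E. Proof. by rewrite lee_fin outer_value_ge0. Qed.

Let le_oval : {homo oval : A B / A `<=` B >-> (A <= B)%E}.
Proof. by move=> A B AB; rewrite lee_fin le_outer_value. Qed.

Let oval_mixin := isOuterMeasure.Build R T oval oval0 oval_ge0 le_oval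
  outer_value_sigma_subadditive.

Let om : {outer_measure set T -> \bar R} := HB.pack oval oval_mixin.

Let outer_valueU (A B : set T) : outer_value (A `|` B) <= outer_value A + outer_value B.
Proof. by have := outer_measureU2 om A B; rewrite -EFinD lee_fin. Qed.

(** The functions [phi n] increase to the indicator of [U]. Past some [j] the values [P (phi n)]
    hardly grow, so the part of [U] where [phi (3 * j)] is not yet 1 has small outer value; the rest
    is handled by [outer_value_split]. *)
Let outer_value_open_caratheodory (U : set T) : open U -> forall Z,
  outer_value (Z `&` U) + outer_value (Z `&` ~` U) <= outer_value Z.
Proof.
move=> oU Z; have [h [ch h0 hU hNU]] := open_cozero oU.
apply/ler_addgt0Pr => e e0.
pose phi (n : nat) x := Num.min 1 (n%:R * h x).
have cphi n : continuous (phi n) by apply: cmin => //; exact: cscale.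
have phi01 n x : 0 <= phi n x <= 1.
  by rewrite le_min ler01 mulr_ge0//= ge_min lexx.
have phi_incr n m x : (n <= m)%N -> phi n x <= phi m x.
  move=> nm; rewrite le_min ge_min lexx/= ge_min; apply/orP; right.
  by rewrite ler_wpM2r// ler_nat.
pose S := [set P (phi n) | n in [set: nat]].
have hS : has_sup S.
  split; first by exists (P (phi 0%N)), 0%N.
  exists (P (fun=> 1)) => _ [n _ <-]; apply: le_functional => // x _.
  by have /andP[] := phi01 n x.
have e2 : 0 < e / 2 by rewrite divr_gt0.
have [_ [j _ <-] jS] := sup_adherent e2 hS.
(* On the shell [phi j < 1/3], while [phi n] reaches 1 for large [n], so twice the difference
   exceeds 1; the growth bound [e / 2] becomes [e]. On the rest of [U], [phi (3 * j) = 1]. *)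
pose shell := [set x | 0 < h x /\ 3 * (j%:R * h x) < 1].
have shellE : outer_value shell <= e.
  apply: outer_value_le; exists (fun n x => 2 * (phi (n + j)%N x - phi j x)).
  have cd n : continuous (fun x => phi (n + j)%N x - phi j x).
    by apply: cadd => //; exact: copp.
  split.
  - by move=> n; apply: cscale; exact: cd.
  - by move=> n x; rewrite mulr_ge0// subr_ge0 phi_incr// leq_addl.
  - by move=> n x; rewrite ler_pM2l// lerD2r phi_incr.
  - move=> n; rewrite PZ// functionalB//.
    have : P (phi (n + j)%N) <= sup S by apply: ub_le_sup; [case: hS|exists (n + j)%N].
    by move: jS; lra.
  - move=> x [hx jx] _; exists (Num.trunc (h x)^-1).+1.
    have -> : phi ((Num.trunc (h x)^-1).+1 + j)%N x = 1.
      apply/min_idPl; rewrite -ler_pdivrMr// div1r (le_trans (ltW (truncnS_gt _)))//.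
      by rewrite ler_nat leq_addr.
    have : phi j x <= j%:R * h x by rewrite ge_min lexx orbT.
    by lra.
have ZU : Z `&` U `<=` (Z `&` [set x | phi (3 * j)%N x = 1]) `|` shell.
  move=> x [Zx Ux]; have [hx|hx] := ltP (3 * (j%:R * h x)) 1.
    by right; split => //; exact: hU.
  by left; split => //=; apply/min_idPl; rewrite natrM -mulrA.
have ZNU : Z `&` ~` U `<=` Z `&` [set x | phi (3 * j)%N x = 0].
  by move=> x [Zx /hNU hx]; split => //=; rewrite /phi hx mulr0; apply/min_idPr.
have := outer_value_split Z (cphi (3 * j)%N) (phi01 _).
have := le_outer_value ZU; have := le_outer_value ZNU.
have := outer_valueU (Z `&` [set x | phi (3 * j)%N x = 1]) shell.
lra.
Qed.

(** The outer value restricted to Borel sets, which are Caratheodory measurable because open sets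
    are. The two inequalities between [P] and [mu] take the place of an integral representation. *)
Theorem positive_functional_measure :
  exists mu : {measure set (g_sigma_algebraType (@open T)) -> \bar R},
  [/\ (mu setT < +oo)%E,
      forall (A : set T) (g : T -> R), continuous g -> (forall x, 0 <= g x) ->
        (forall x, X x -> A x -> 1 <= g x) -> (mu A <= (P g)%:E)%E,
      forall (A : set T) (g : T -> R), continuous g ->
        (forall x, X x -> A x -> g x <= 1) -> (forall x, X x -> ~ A x -> g x <= 0) ->
        ((P g)%:E <= mu A)%E
    & forall (A : set T) (e : R), 0 < e ->
        exists U, [/\ open U, A `<=` U & (mu U <= mu A + e%:E)%E]].
Proof.
have sub (A : set (g_sigma_algebraType (@open T))) : measurable A -> om.-cara.-measurable A.
  apply: smallest_sub; first exact: (sigma_algebra_measurable (caratheodory_type om)).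
  move=> U oU; apply: le_caratheodory_measurable => Z.
  by rewrite lee_fin; exact: outer_value_open_caratheodory.
have sadd : semi_sigma_additive (oval : set (g_sigma_algebraType (@open T)) -> _).
  move=> F mF tF mUF.
  by apply: (@caratheodory_measure_sigma_additive _ _ om) => // [n|]; exact: sub.
pose mx := isMeasure.Build _ (g_sigma_algebraType (@open T)) R oval oval0 oval_ge0 sadd.
pose mu : {measure set (g_sigma_algebraType (@open T)) -> \bar R} := HB.pack oval mx.
exists mu; split.
- by rewrite ltey.
- by move=> A g cg g0 gA; rewrite lee_fin outer_value_le_functional.
- by move=> A g cg gA gNA; rewrite lee_fin functional_le_outer_value.
- move=> A e e0; have [U [oU AU UA]] := outer_value_open A e0.
  by exists U; split => //; rewrite -EFinD lee_fin.
Qed.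

End PositiveFunctional.

(** * The tree structure of the orbits *)

Section AlternatingCycles.
Variables (R : realType) (T : eqType) (X : set T) (pr : bool -> T -> R).

(** An infinite alternating walk that is back at its start after [2n] steps; its continuation need
    not be periodic. *)
Definition alternating_cycle (n : nat) (p : nat -> T) :=
  [/\ (0 < n)%N, forall i, X (p i), forall i, p i <> p i.+1,
      forall i, pr (odd i) (p i) = pr (odd i) (p i.+1) & p n.*2 = p 0%N].

(* Finitely supported real weights on [T] are lists of weighted points. *)
Definition weight (L : seq (R * T)) (p : T) : R :=
  \sum_(x <- L) x.1 * (x.2 == p)%:R.

Definition line_weight (L : seq (R * T)) (c : bool) (v : R) : R :=
  \sum_(x <- L) x.1 * (pr c x.2 == v)%:R.

Lemma line_weightE L c v : line_weight L c v =
  \sum_(q <- undup [seq x.2 | x <- L]) (pr c q == v)%:R * weight L q.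
Proof.
under eq_bigr do rewrite /weight mulr_sumr.
rewrite exchange_big/= /line_weight; apply: eq_big_seq => x xL.
have xu : x.2 \in undup [seq x.2 | x <- L] by rewrite mem_undup map_f.
rewrite (bigD1_seq x.2)//= ?undup_uniq// big1 => [|q /negbTE qx].
  by rewrite eqxx mulr1 addr0 mulrC.
by rewrite [x.2 == q]eq_sym qx !mulr0.
Qed.

Lemma weight_mem L p : weight L p != 0 -> p \in [seq x.2 | x <- L].
Proof.
apply: contra_neqT => pL; rewrite /weight big_seq big1// => x xL.
have [xp|_] := eqVneq x.2 p; last by rewrite mulr0.
by case/negP: pL; rewrite -xp map_f.
Qed.

Lemma balanced_step L c p : weight L p != 0 -> line_weight L c (pr c p) = 0 ->
  exists p', [/\ weight L p' != 0, p <> p' & pr c p = pr c p'].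
Proof.
move=> Lp; rewrite line_weightE => L0; apply: contrapT => H.
have pu : p \in undup [seq x.2 | x <- L] by rewrite mem_undup weight_mem.
move: L0; rewrite (bigD1_seq p)//= ?undup_uniq// eqxx mul1r big1 ?addr0.
  by move/eqP; rewrite (negbTE Lp).
move=> q qp; have [prq|_] := eqVneq (pr c q) (pr c p); last by rewrite mul0r.
rewrite mul1r; apply/eqP; apply/negPn/negP => Lq; apply: H; exists q; split => //.
by apply/eqP; rewrite eq_sym.
Qed.

(* Following lines of alternating directions never leaves the finite support of
   a balanced weight. *)
Lemma balanced_cycle L p0 : weight L p0 != 0 ->
  (forall p, weight L p != 0 -> X p) ->
  (forall c v, line_weight L c v = 0) -> exists n p, alternating_cycle n p.
Proof.
move=> Lp0 LX L0.
have /choice[next nextP] (cp : bool * T) : exists p', weight L cp.2 != 0 ->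
    [/\ weight L p' != 0, cp.2 <> p' & pr cp.1 cp.2 = pr cp.1 p'].
  have [Lp|Lp] := eqVneq (weight L cp.2) 0; first by exists cp.2.
  by have [p' Hp'] := balanced_step Lp (L0 cp.1 _); exists p'.
pose p := fix p i := if i is i'.+1 then next (odd i', p i') else p0.
have Lp i : weight L (p i) != 0.
  by elim: i => [//|i IH] /=; have [] := nextP (odd i, p i) IH.
set s := [seq x.2 | x <- L].
(* Pigeonhole on even indices only, so that the return takes an even number of steps and the
   directions match. *)
have : ~~ uniq [seq p i.*2 | i <- iota 0 (size s).+1].
  apply/negP => us.
  have : {subset [seq p i.*2 | i <- iota 0 (size s).+1] <= s}.
    by move=> _ /mapP[i _ ->]; exact: weight_mem.
  by move=> /(uniq_leq_size us); rewrite size_map size_iota ltnn.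
move/(uniqPn p0) => [i [j [ij]]]; rewrite size_map size_iota => js.
have is' : (i < (size s).+1)%N by exact: ltn_trans ij js.
rewrite !(nth_map 0%N) ?size_iota// !nth_iota// !add0n => pij.
exists (j - i)%N, (fun k => p (i.*2 + k)%N); split.
- by rewrite subn_gt0.
- by move=> k; exact: LX.
- by move=> k; rewrite addnS; have [] := nextP (odd (i.*2 + k), p (i.*2 + k)%N) (Lp _).
- move=> k; rewrite addnS.
  have [_ _] := nextP (odd (i.*2 + k), p (i.*2 + k)%N) (Lp _).
  by rewrite /= oddD odd_double.
- by rewrite addn0 -doubleD subnKC// ltnW.
Qed.

Lemma weight_cat L L' p : weight (L ++ L') p = weight L p + weight L' p.
Proof. by rewrite /weight big_cat. Qed.

Lemma line_weight_cat L L' c v :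
  line_weight (L ++ L') c v = line_weight L c v + line_weight L' c v.
Proof. by rewrite /line_weight big_cat. Qed.

Definition wopp (L : seq (R * T)) := [seq (- x.1, x.2) | x <- L].

Lemma weight_opp L p : weight (wopp L) p = - weight L p.
Proof.
by rewrite /weight big_map -sumrN; apply: eq_bigr => x _; rewrite /= mulNr.
Qed.

Lemma line_weight_opp L c v : line_weight (wopp L) c v = - line_weight L c v.
Proof.
by rewrite /line_weight big_map -sumrN; apply: eq_bigr => x _; rewrite /= mulNr.
Qed.

Section Layers.
(** Later the least value of [pr false] on the orbit of the point; [root_line] then collects the
    leftmost lines of all orbits at once. *)
Variable m : T -> R.
Hypothesis m_inv : forall z w c, X z -> X w -> pr c z = pr c w -> m z = m w.
Hypothesis acyclic : ~ exists n p, alternating_cycle n p.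

Definition neighbors (A : set T) : set T :=
  [set z | X z /\ exists2 w, A w & exists c, pr c z = pr c w].

Definition root_line : set T := [set z | X z /\ pr false z = m z].

Definition ball_layer (n : nat) : set T := iter n neighbors root_line.

Definition layer (n : nat) : set T :=
  if n is n'.+1 then ball_layer n'.+1 `\` ball_layer n' else root_line.

Lemma ball_layer_sub n : ball_layer n `<=` X.
Proof. by case: n => [z []|n z []]. Qed.

Lemma ball_layerS n : ball_layer n `<=` ball_layer n.+1.
Proof.
move=> z Gz; split; first exact: ball_layer_sub Gz.
by exists z => //; exists false.
Qed.

Lemma ball_layer_le n k : (n <= k)%N -> ball_layer n `<=` ball_layer k.
Proof.
elim: k => [|k IH]; first by rewrite leqn0 => /eqP->.
rewrite leq_eqVlt => /orP[/eqP->//|/IH] /subset_trans; apply; exact: ball_layerS.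
Qed.

Lemma layer_sub n : layer n `<=` ball_layer n.
Proof. by case: n => [|n] // z []. Qed.

Lemma ball_layer_layer n z : ball_layer n z -> exists2 j, (j <= n)%N & layer j z.
Proof.
elim: n => [|n IH] Gz; first by exists 0%N.
have [/IH[j jn Dj]|Gnz] := pselect (ball_layer n z).
  by exists j => //; exact: leqW.
by exists n.+1.
Qed.

Lemma layer_notin n k z : layer n z -> (k < n)%N -> ~ ball_layer k z.
Proof.
case: n => [//|n] [_ Gn]; rewrite ltnS => kn Gk; apply: Gn; exact: ball_layer_le Gk.
Qed.

(** Parity forces the direction. A line of direction [false] through a root point consists of root
    points; further down, a step in the direction that already joins [w] to its parent would put [z]
    on the parent's line, one layer nearer to the root. *)
Lemma layer_parent n z : layer n.+1 z ->
  exists2 w, layer n w & pr (odd n.+1) z = pr (odd n.+1) w.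
Proof.
elim: n z => [|n IH] z [[Xz [w Gw [c zw]]] Gz].
  case: c zw => zw; first by exists w.
  case: Gz; split => //; have [Xw wm] := Gw.
  by rewrite zw wm; exact/esym/(m_inv Xz Xw zw).
have Dw : layer n.+1 w.
  split => // Gw'; apply: Gz; split => //; exists w => //; by exists c.
exists w => //; have [co|cno] := eqVneq c (odd n.+2); first by rewrite -co.
have cE : c = odd n.+1 by move: cno => /=; case: c zw; case: (odd n).
have [w' Dw' ww'] := IH w Dw.
case: Gz; split => //; exists w'; first exact: layer_sub.
by exists c; rewrite zw cE.
Qed.

(* The alternating sum of the path from [z] to the root line has zero sum on
   every line, except on the root line and on the line leaving [z] downwards. *)
Lemma layer_weight n z : layer n z -> exists L,
  [/\ forall p, weight L p != 0 -> X p, weight L z = 1,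
      forall p, weight L p != 0 -> p = z \/ exists2 k, (k < n)%N & ball_layer k p
    & forall c v, line_weight L c v =
        ((c == ~~ odd n) && (v == pr c z))%:R +
        (-1) ^+ n * (~~ c && (v == m z))%:R].
Proof.
elim: n z => [|n IH] z Dz.
  exists [:: (1, z)]; split.
  - move=> p /weight_mem; rewrite inE => /eqP ->; by have [] := Dz.
  - by rewrite /weight big_seq1 eqxx mulr1.
  - by move=> p /weight_mem; rewrite inE => /eqP ->; left.
  - move=> c v; rewrite /line_weight big_seq1 mul1r expr0 mul1r /= eq_sym.
    case: c => /=; first by rewrite addr0.
    by have [_ ->] := Dz; rewrite add0r.
have [w Dw zw] := layer_parent Dz; have [L [LX L1 LG Ll]] := IH w Dw.
have Xz : X z by apply: ball_layer_sub (layer_sub Dz).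
have Xw : X w by apply: ball_layer_sub (layer_sub Dw).
have wE p : weight ((1, z) :: wopp L) p = (z == p)%:R - weight L p.
  by rewrite -cat1s weight_cat weight_opp /weight big_seq1 mul1r.
exists ((1, z) :: wopp L); split.
- move=> p; rewrite wE; have [<-//|_] := eqVneq z p.
  by rewrite sub0r oppr_eq0; exact: LX.
- rewrite wE eqxx; have [->|/LG Lz] := eqVneq (weight L z) 0; first by rewrite subr0.
  exfalso; case: Lz => [zw'|[k kn Gk]].
    by apply: (layer_notin Dz (ltnSn n)); rewrite zw'; exact: layer_sub.
  by apply: (layer_notin Dz _ Gk); exact: leqW.
- move=> p; rewrite wE; have [<-|_] := eqVneq z p; first by left.
  rewrite sub0r oppr_eq0 => /LG[->|[k kn Gk]]; right.
    by exists n => //; exact: layer_sub.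
  by exists k => //; exact: leqW.
- move=> c v; rewrite -cat1s line_weight_cat line_weight_opp Ll.
  rewrite /line_weight big_seq1 mul1r exprS (m_inv Xz Xw zw) [odd n.+1]/= negbK.
  rewrite eq_sym opprD mulN1r mulNr addrA; congr (_ + _).
  have [->|cno] := eqVneq c (~~ odd n).
    by rewrite zw subrr; case: (odd n).
  have -> : c = odd n by move: cno; case: (c); case: (odd n).
  by rewrite andFb mulr0n subr0 eqxx.
Qed.

(** Subtract the alternating sum of [w] from that of [z]: the contributions of the common line
    cancel, and so do those of the root line, the parities being equal. The result is balanced and
    has weight 1 at [z], so it yields a cycle. *)
Let layer_line_same n j z w : layer n z -> layer j w -> (j <= n)%N ->
  odd j = odd n -> w <> z -> pr (~~ odd n) w <> pr (~~ odd n) z.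
Proof.
move=> Dz Dw jn ojn wz wzE.
have [L [LX L1 LG Ll]] := layer_weight Dz; have [K [KX K1 KG Kl]] := layer_weight Dw.
have Xz : X z by apply: ball_layer_sub (layer_sub Dz).
have Xw : X w by apply: ball_layer_sub (layer_sub Dw).
have Kz : weight K z = 0.
  apply/eqP/negPn/negP => /KG[/esym//|[k kj Gk]].
  by apply: (layer_notin Dz _ Gk); exact: leq_trans kj jn.
apply: acyclic; apply: (@balanced_cycle (L ++ wopp K) z).
- by rewrite weight_cat weight_opp Kz L1 subr0 oner_neq0.
- move=> p; rewrite weight_cat weight_opp.
  have [L0|/LX//] := eqVneq (weight L p) 0.
  by rewrite L0 sub0r oppr_eq0; exact: KX.
- move=> c v; rewrite line_weight_cat line_weight_opp Ll Kl ojn.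
  rewrite -(m_inv Xw Xz wzE) -(signr_odd R j) ojn signr_odd.
  have [->|_] := eqVneq c (~~ odd n); last by rewrite subrr.
  by rewrite wzE subrr.
Qed.

(** Suppose [w] is in a layer [j <= n]. Equal parity is excluded by [layer_line_same]. With opposite
    parity the common line joins [w] to its parent, and that parent, of the parity of [n], is
    excluded likewise; for [j = 0] the line is the root line, and [z] would be a root point. *)
Lemma layer_descend n z w : layer n z -> X w -> w <> z ->
  pr (~~ odd n) w = pr (~~ odd n) z -> layer n.+1 w.
Proof.
move=> Dz Xw wz wzE; have Xz : X z by apply: ball_layer_sub (layer_sub Dz).
split.
  by split => //; exists z; [exact: layer_sub|exists (~~ odd n)].
move=> /ball_layer_layer[j jn Dw].
have [ojn|ojn] := eqVneq (odd j) (odd n); first exact: layer_line_same ojn wz wzE.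
have {}jn : (j < n)%N.
  by rewrite ltn_neqAle jn andbT; apply: contraNneq ojn => ->.
have oE : ~~ odd n = odd j by move: ojn; case: (odd j); case: (odd n).
rewrite oE in wzE; case: j Dw ojn jn oE wzE => [|j] Dw ojn jn oE wzE.
  have [_ wr] := Dw; have : ball_layer 0 z.
    split => //; by rewrite -wzE wr; exact: m_inv wzE.
  exact: layer_notin jn.
have [w' Dw' ww'] := layer_parent Dw.
have w'z : w' <> z.
  move=> w'zE; apply: (layer_notin Dz (ltnW jn)); rewrite -w'zE; exact: layer_sub.
apply: (layer_line_same Dz Dw' (ltnW (ltnW jn)) _ w'z).
  by move: oE => /=; case: (odd j); case: (odd n).
by rewrite oE -ww' wzE.
Qed.

End Layers.
End AlternatingCycles.

Section Reach.
Variables (R : realType) (T : eqType) (X : set T) (pr : bool -> T -> R).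

Definition reach (n : nat) (A : set T) : set T := iter n (neighbors X pr) A.

Lemma reach_sub n A : A `<=` X -> reach n A `<=` X.
Proof. by case: n => [//|n] _ z []. Qed.

Lemma reach_mono n A B : A `<=` B -> reach n A `<=` reach n B.
Proof.
elim: n => [//|n IH] AB z [Xz [w Aw zw]]; split => //; exists w => //; exact: IH Aw.
Qed.

Lemma reach_point n A z : reach n A z -> exists2 w, A w & reach n [set w] z.
Proof.
elim: n z => [|n IH] z; first by exists z.
move=> [Xz [w /IH[w' Aw' ww'] zw]]; exists w' => //; split => //; by exists w.
Qed.

Lemma reachSr n z w : reach n (neighbors X pr [set w]) z = reach n.+1 [set w] z.
Proof. by rewrite /reach iterSr. Qed.

Lemma reach_step n c z w w' : X w -> X w' -> pr c w = pr c w' ->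
  reach n [set w] z -> reach n.+1 [set w'] z.
Proof.
move=> Xw Xw' ww'; rewrite -reachSr; apply: reach_mono => _ ->.
by split => //; exists w' => //; exists c.
Qed.

Lemma reach_sym n z w : X z -> X w -> reach n [set w] z -> reach n [set z] w.
Proof.
elim: n z => [|n IH] z Xz Xw; first by move=> ->.
move=> [_ [y wy [c zy]]].
have Xy : X y by apply: reach_sub wy => _ ->.
exact: reach_step Xy Xz (esym zy) (IH y Xy Xw wy).
Qed.

Lemma reach_le n k A : A `<=` X -> (n <= k)%N -> reach n A `<=` reach k A.
Proof.
move=> AX; elim: k => [|k IH]; first by rewrite leqn0 => /eqP->.
rewrite leq_eqVlt => /orP[/eqP->//|/IH] /subset_trans; apply.
by move=> z Az; split; [exact: reach_sub Az|exists z => //; exists false].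
Qed.

End Reach.

(** * Minima on orbits and measurability of the layers *)

Section OrbitMinimum.
Variables (R : realType) (T : normedModType R) (X : set T) (pr : bool -> T -> R).
Hypothesis cX : compact X.
Hypothesis cpr : forall c, continuous (pr c).
Hypothesis attained : forall z, X z -> exists k w, reach X pr k [set z] w /\
  forall j w', reach X pr j [set z] w' -> pr false w <= pr false w'.

(** The image of a compact set is compact, hence closed; for a general Borel set the union of the
    lines through it may fail to be Borel. *)
Lemma saturation_compact (A : set T) c : compact A ->
  compact (X `&` pr c @^-1` (pr c @` A)).
Proof.
move=> cA; apply: compact_closedI => //; apply: closed_comp => [x _|]; first exact: cpr.
apply: compact_closed; first exact: Rhausdorff.
by apply: continuous_compact => //; apply: continuous_subspaceT; exact: cpr.
Qed.

Lemma neighbors_compact (A : set T) : compact A -> compact (neighbors X pr A).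
Proof.
move=> cA; rewrite (_ : neighbors X pr A =
  (X `&` pr false @^-1` (pr false @` A)) `|` (X `&` pr true @^-1` (pr true @` A))).
  by apply: compactU; exact: saturation_compact.
apply/seteqP; split=> z.
  by move=> [Xz [w Aw [[] zw]]]; [right|left]; split => //; exists w.
by move=> [] [Xz [w Aw zw]]; split => //; exists w => //; [exists false|exists true].
Qed.

Lemma reach_compact n (A : set T) : compact A -> compact (reach X pr n A).
Proof. by move=> cA; elim: n => [//|n IH]; exact: neighbors_compact. Qed.

Lemma orbit_minimum : exists m : T -> R,
  [/\ forall z w c, X z -> X w -> pr c z = pr c w -> m z = m w,
     forall z, X z -> exists k w, reach X pr k [set z] w /\ pr false w = m z
   & forall z k w, X z -> reach X pr k [set z] w -> m z <= pr false w].
Proof.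
have /choice[m mP] z : exists v, X z ->
    (exists k w, reach X pr k [set z] w /\ pr false w = v) /\
    (forall k w, reach X pr k [set z] w -> v <= pr false w).
  have [Xz|Xz] := pselect (X z); last by exists 0.
  have [k [w [zw wmin]]] := attained Xz.
  by exists (pr false w) => _; split; [exists k, w|].
have m_le z w c : X z -> X w -> pr c z = pr c w -> m z <= m w.
  move=> Xz Xw zw; have [[k [y [wy <-]]] _] := mP w Xw.
  apply: (mP z Xz).2; exact: reach_step Xw Xz (esym zw) wy.
exists m; split.
- move=> z w c Xz Xw zw; apply/eqP; rewrite eq_le.
  by rewrite (m_le _ _ _ Xz Xw zw) (m_le _ _ _ Xw Xz (esym zw)).
- by move=> z Xz; have [] := mP z Xz.
- by move=> z k w Xz; have [_] := mP z Xz; exact.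
Qed.

Variable m : T -> R.
Hypothesis m_inv : forall z w c, X z -> X w -> pr c z = pr c w -> m z = m w.
Hypothesis m_reach : forall z, X z -> exists k w, reach X pr k [set z] w /\ pr false w = m z.
Hypothesis m_min : forall z k w, X z -> reach X pr k [set z] w -> m z <= pr false w.

Let m_reach_eq k z w : X z -> reach X pr k [set z] w -> m w = m z.
Proof.
elim: k w => [w _ ->//|k IH] w Xz [Xw [y zy [c wy]]].
have Xy : X y by apply: reach_sub zy => _ ->.
by rewrite (m_inv Xw Xy wy); exact: IH.
Qed.

Let ball_layer_reach n z : X z ->
  ball_layer X pr m n z <-> exists2 w, reach X pr n [set z] w & pr false w = m z.
Proof.
move=> Xz; split.
  move=> /reach_point[w [Xw wm] wz]; exists w; first exact: reach_sym.
  by rewrite wm; apply/esym; exact: m_reach_eq wz.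
move=> [w zw wm].
have Xw : X w by apply: reach_sub zw => _ ->.
apply: (@reach_mono _ _ _ _ n [set w]) => [_ ->|]; last exact: reach_sym.
by split => //; rewrite wm (m_reach_eq Xz zw).
Qed.

Lemma ball_layer_cover : \bigcup_n ball_layer X pr m n = X.
Proof.
apply/seteqP; split=> z; first by move=> [n _]; exact: ball_layer_sub.
move=> Xz; have [k [w [zw wm]]] := m_reach Xz.
by exists k => //; apply/ball_layer_reach => //; exists w.
Qed.

Let sub_level (q : rat) : set T := X `&` [set x | pr false x <= ratr q].

(** Semicontinuity tested at rational levels: whenever the orbit of [z] descends to level [q], it
    does so within [n] steps. Conversely, a rational strictly between [m z] and the minimum attained
    within [n] steps would violate this. *)
Lemma ball_layerE n : ball_layer X pr m n = X `&`
  \bigcap_(q : rat) (reach X pr n (sub_level q) `|` ~` \bigcup_k reach X pr k (sub_level q)).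
Proof.
have subX q : sub_level q `<=` X by move=> x [].
apply/seteqP; split=> z.
  move=> Gz; have Xz : X z by exact: ball_layer_sub Gz.
  split => // q _; have /(ball_layer_reach _ Xz)[w zw wm] := Gz.
  have Xw : X w by apply: reach_sub zw => _ ->.
  have [[k _ zq]|] := pselect ((\bigcup_k reach X pr k (sub_level q)) z); last by right.
  left; have [y [Xy yq] yz] := reach_point zq.
  have mq : m z <= ratr q.
    by rewrite (le_trans _ yq)//; apply: (m_min (k := k)) => //; exact: reach_sym.
  apply: (@reach_mono _ _ _ _ n [set w]) => [_ ->|]; last exact: reach_sym.
  by split => //=; rewrite wm.
move=> [Xz Hq]; apply/ball_layer_reach => //.
have cR : compact (reach X pr n [set z]) by apply: reach_compact; exact: compact_set1.
have zz : reach X pr n [set z] z.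
  by apply: (@reach_le _ _ _ _ 0) => // _ ->.
have R0 : reach X pr n [set z] !=set0 by exists z.
have [w] := compact_EVT_min R0 cR (continuous_subspaceT (@cpr false)).
rewrite inE => zw wmin; exists w => //; apply/eqP; rewrite eq_le (m_min Xz zw) andbT.
rewrite leNgt; apply/negP => /rat_in_itvoo[q]; rewrite in_itv/= => /andP[mq qw].
have [zq|] := Hq q I; last first.
  case; have [k [y [zy ym]]] := m_reach Xz; exists k => //.
  have Xy : X y by apply: reach_sub zy => _ ->.
  apply: (@reach_mono _ _ _ _ k [set y]) => [_ ->|]; last exact: reach_sym.
  by split => //=; rewrite ym ltW.
have [y [Xy yq] yz] := reach_point zq.
have zy : reach X pr n [set z] y by exact: reach_sym.
by have := wmin y; rewrite inE => /(_ zy); rewrite leNgt (le_lt_trans yq).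
Qed.

Lemma closed_borel (A : set T) : closed A ->
  measurable (A : set (g_sigma_algebraType (@open T))).
Proof.
move=> cA; rewrite -[A]setCK; apply: measurableC; apply: sub_sigma_algebra.
exact: closed_openC.
Qed.

Lemma compact_borel (A : set T) : compact A ->
  measurable (A : set (g_sigma_algebraType (@open T))).
Proof. by move=> cA; apply: closed_borel; apply: compact_closed => //; exact: norm_hausdorff. Qed.

Lemma ball_layer_measurable n :
  measurable (ball_layer X pr m n : set (g_sigma_algebraType (@open T))).
Proof.
have mr k q : measurable (reach X pr k (sub_level q) : set (g_sigma_algebraType (@open T))).
  apply: compact_borel; apply: reach_compact; apply: compact_closedI => //.
  rewrite (_ : [set x | _] = pr false @^-1` [set y | y <= ratr q])//.
  by apply: closed_comp => [x _|]; [exact: cpr|exact: closed_le].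
rewrite ball_layerE; apply: measurableI; first exact: compact_borel.
rewrite -[X in measurable X]setCK setC_bigcap; apply: measurableC.
apply: bigcupT_measurable_rat => q; apply: measurableC; apply: measurableU => //.
by apply: measurableC; apply: bigcupT_measurable.
Qed.

Lemma layer_measurable n :
  measurable (layer X pr m n : set (g_sigma_algebraType (@open T))).
Proof.
case: n => [|n]; first exact: (ball_layer_measurable 0).
by apply: measurableD; exact: ball_layer_measurable.
Qed.

End OrbitMinimum.

(** * Measures with equal images under both projections *)

Section BalancedMeasures.
Variables (R : realType) (T : normedModType R) (X : set T) (pr : bool -> T -> R).
Hypothesis cX : compact X.
Hypothesis cpr : forall c, continuous (pr c).
Hypothesis acyclic : ~ exists n p, alternating_cycle X pr n p.
Variable m : T -> R.
Hypothesis m_inv : forall z w c, X z -> X w -> pr c z = pr c w -> m z = m w.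
Hypothesis m_reach : forall z, X z -> exists k w, reach X pr k [set z] w /\ pr false w = m z.
Hypothesis m_min : forall z k w, X z -> reach X pr k [set z] w -> m z <= pr false w.

Local Notation B := (g_sigma_algebraType (@open T)).

Variables mu nu : {measure set B -> \bar R}.
Hypothesis mu_fin : (mu setT < +oo)%E.
Hypothesis nu_fin : (nu setT < +oo)%E.
Hypothesis mu_reg : forall (A : set T) e, 0 < e ->
  exists U, [/\ open U, A `<=` U & (mu U <= mu A + e%:E)%E].
Hypothesis nu_reg : forall (A : set T) e, 0 < e ->
  exists U, [/\ open U, A `<=` U & (nu U <= nu A + e%:E)%E].
Hypothesis same_marginals : forall c (C : set R), compact C ->
  mu (X `&` pr c @^-1` C) = nu (X `&` pr c @^-1` C).

Let finite_fin_num (la : {measure set B -> \bar R}) (A : set B) :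
  (la setT < +oo)%E -> measurable A -> la A \is a fin_num.
Proof.
move=> laoo mA; rewrite ge0_fin_numE//.
by apply: le_lt_trans laoo; apply: le_measure; rewrite ?inE.
Qed.

(** The signed measure to be shown zero; [total] is a positive measure that dominates its variation
    and stands in for a Jordan decomposition. *)
Let diff (A : set B) : R := fine (mu A) - fine (nu A).
Let total (A : set B) : R := fine (mu A) + fine (nu A).

Let fineU (la : {measure set B -> \bar R}) (A C : set B) : (la setT < +oo)%E ->
  measurable A -> measurable C -> [disjoint A & C] ->
  fine (la (A `|` C)) = fine (la A) + fine (la C).
Proof.
by move=> laoo mA mC /eqP AC; rewrite measureU// fineD//; exact: finite_fin_num.
Qed.

Let diffU (A C : set B) : measurable A -> measurable C -> [disjoint A & C] ->
  diff (A `|` C) = diff A + diff C.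
Proof. by move=> mA mC AC; rewrite /diff !fineU//; lra. Qed.

Let fine_le (la : {measure set B -> \bar R}) (A C : set B) : (la setT < +oo)%E ->
  measurable A -> measurable C -> A `<=` C -> fine (la A) <= fine (la C).
Proof.
move=> laoo mA mC AC; apply: fine_le; [exact: finite_fin_num..|].
by apply: le_measure; rewrite ?inE.
Qed.

Let total_le (A C : set B) : measurable A -> measurable C -> A `<=` C -> total A <= total C.
Proof. by move=> mA mC AC; apply: lerD; exact: fine_le. Qed.

Let diff_le_total (A : set B) : `|diff A| <= total A.
Proof.
by rewrite (le_trans (ler_normB _ _))// !ger0_norm// fine_ge0.
Qed.

Let inner_regular1 (la : {measure set B -> \bar R}) (A : set B) e :
  (la setT < +oo)%E ->
  (forall (A : set T) e, 0 < e ->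
    exists U, [/\ open U, A `<=` U & (la U <= la A + e%:E)%E]) ->
  measurable A -> 0 < e -> exists C : set T,
    [/\ closed C, C `<=` A & fine (la (A `\` C)) <= e].
Proof.
move=> laoo reg mA e0; have [U [oU AU Ue]] := reg (~` A) e e0.
have mU : measurable (U : set B) by exact: sub_sigma_algebra.
exists (~` U); split; [exact: open_closedC|exact: subsetCl|].
rewrite setDE setCK.
have UE : U = (~` A) `|` (A `&` U) :> set T.
  by rewrite setUIr setUCl setTI setUidr.
rewrite -(lerD2l (fine (la (~` A)))) -fineU//; [|exact: measurableC|exact: measurableI|].
  rewrite -UE -lee_fin EFinD !fineK//; apply: finite_fin_num => //; exact: measurableC.
by rewrite /disj_set setIA setICl set0I.
Qed.

Let inner_regular (A : set B) e : measurable A -> 0 < e ->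
  exists C : set T, [/\ closed C, C `<=` A & total (A `\` C) <= e].
Proof.
move=> mA e0; have e2 : 0 < e / 2 by rewrite divr_gt0.
have [C [cC CA Ce]] := inner_regular1 mu_fin mu_reg mA e2.
have [D [cD DA De]] := inner_regular1 nu_fin nu_reg mA e2.
have mC := closed_borel cC; have mD := closed_borel cD.
exists (C `|` D); split; [exact: closedU|by rewrite subUset|].
have : fine (mu (A `\` (C `|` D))) <= fine (mu (A `\` C)).
  apply: fine_le => //; [|exact: measurableD|by apply: setDS; exact: subsetUl].
  by apply: measurableD => //; exact: measurableU.
have : fine (nu (A `\` (C `|` D))) <= fine (nu (A `\` D)).
  apply: fine_le => //; [|exact: measurableD|by apply: setDS; exact: subsetUr].
  by apply: measurableD => //; exact: measurableU.
rewrite /total; lra.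
Qed.

Let mlayer n : measurable (layer X pr m n : set B).
Proof. exact: layer_measurable. Qed.

Let mball n : measurable (ball_layer X pr m n : set B).
Proof. exact: ball_layer_measurable. Qed.

Let mX : measurable (X : set B). Proof. exact: compact_borel. Qed.

(* The mass of a part of layer [n] is balanced, along the lines leaving it
   downwards, by the opposite mass on layer [n + 1]. *)
Let diff_layer k n (A : set B) e : measurable A -> A `<=` layer X pr m n -> 0 < e ->
  `|diff A| <= e + total (layer X pr m (n + k)).
Proof.
elim: k n A e => [|k IH] n A e mA An e0.
  rewrite addn0 (le_trans (diff_le_total A))// (le_trans (total_le mA (mlayer n) An))//.
  by rewrite lerDr ltW.
have e2 : 0 < e / 2 by rewrite divr_gt0.
(* For a compact part [C], the union [N] of the lines through it is compact. Equal marginals give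
   [diff N = 0], so [N] minus [C], which lies in the next layer, carries exactly [- diff C]. *)
have [C [cC CA Ce]] := inner_regular mA e2.
have mC := closed_borel cC.
have CX : C `<=` X by move=> z /CA /An /layer_sub; exact: ball_layer_sub.
have kC : compact C by exact: subclosed_compact CX.
pose N : set T := X `&` pr (~~ odd n) @^-1` (pr (~~ odd n) @` C).
have mN : measurable (N : set B) by apply: compact_borel; exact: saturation_compact.
have CN : C `<=` N by move=> z Cz; split; [exact: CX|exists z].
have NC : (N `\` C) `<=` layer X pr m n.+1.
  move=> w [[Xw [z Cz zw]] Cw]; apply: (@layer_descend _ _ _ _ _ m_inv acyclic n z) => //.
    by apply: An; exact: CA.
  by move=> wz; apply: Cw; rewrite wz.
have mNC : measurable (N `\` C : set B) by exact: measurableD.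
have N0 : diff N = 0.
  rewrite /diff /N same_marginals ?subrr//.
  by apply: continuous_compact => //; apply: continuous_subspaceT; exact: cpr.
have NE : diff N = diff C + diff (N `\` C).
  rewrite -diffU ?setUDK//; first by rewrite setDUK.
  by rewrite /disj_set setDIK.
have AE : diff A = diff C + diff (A `\` C).
  rewrite -diffU//; [by rewrite setDUK|exact: measurableD|].
  by rewrite /disj_set setDIK.
have := IH n.+1 _ _ mNC NC e2; rewrite addSnnS.
have := diff_le_total (A `\` C).
have -> : diff (N `\` C) = - diff C by move: NE; rewrite N0; lra.
rewrite normrN AE; have := ler_normD (diff C) (diff (A `\` C)); lra.
Qed.

Let tail_small e : 0 < e -> exists k, total (X `\` ball_layer X pr m k) <= e.
Proof.
move=> e0; pose F k : set B := X `\` ball_layer X pr m k.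
have mF k : measurable (F k) by exact: measurableD.
have F0 : \bigcap_k F k = set0.
  apply/seteqP; split=> z //= Hz; have [Xz _] := Hz 0%N I.
  have : (\bigcup_n ball_layer X pr m n) z by rewrite (ball_layer_cover m_inv m_reach).
  by move=> [k _ Gk]; have [] := Hz k I.
have dF : nonincreasing_seq F.
  by move=> i j ij; apply/subsetPset; apply: setDS; exact: ball_layer_le.
have cvgF (la : {measure set B -> \bar R}) : (la setT < +oo)%E ->
    exists k, forall j, (k <= j)%N -> fine (la (F j)) <= e / 2.
  move=> laoo; have e2 : 0 < e / 2 by rewrite divr_gt0.
  have : la \o F @ \oo --> la (\bigcap_k F k).
    apply: nonincreasing_cvg_mu => //; last by rewrite F0.
    by rewrite -ge0_fin_numE//; exact: finite_fin_num.
  rewrite F0 measure0 => /fine_cvgP[_ /cvgr_le /(_ _ e2)[k _ Hk]].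
  by exists k => j kj; exact: Hk.
have [k Hk] := cvgF mu mu_fin; have [j Hj] := cvgF nu nu_fin.
exists (maxn k j); have := Hk _ (leq_maxl k j); have := Hj _ (leq_maxr k j).
rewrite /total /F; lra.
Qed.

Let diff_layer0 n (A : set B) : measurable A -> A `<=` layer X pr m n -> diff A = 0.
Proof.
move=> mA An; apply/eqP; rewrite -normr_eq0 eq_le normr_ge0 andbT.
apply/ler_addgt0Pr => e e0; rewrite add0r.
have e2 : 0 < e / 2 by rewrite divr_gt0.
have [k Hk] := tail_small e2.
have := diff_layer k.+1 mA An e2.
(* Layer [n + k + 1] avoids the points within [k] steps of the root, and little mass remains
   there. *)
have : total (layer X pr m (n + k.+1)) <= total (X `\` ball_layer X pr m k).
  apply: total_le => //; first exact: measurableD.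
  rewrite addnS => z Dz; split; first exact: ball_layer_sub (layer_sub Dz).
  by apply: layer_notin Dz _; rewrite ltnS leq_addl.
lra.
Qed.

Let diff_ball0 k (A : set B) : measurable A -> diff (A `&` ball_layer X pr m k) = 0.
Proof.
move=> mA; elim: k => [|k IH].
  by apply: (@diff_layer0 0); [exact: measurableI|move=> z []].
rewrite (_ : A `&` _ = (A `&` ball_layer X pr m k) `|` (A `&` layer X pr m k.+1)).
  rewrite diffU; [|exact: measurableI..|].
    rewrite IH add0r; apply: (@diff_layer0 k.+1); first exact: measurableI.
    by move=> z [].
  rewrite /disj_set; apply/eqP/seteqP; split=> // z [[_ Gz] [_ [_ nGz]]]; exact: nGz.
rewrite -setIUr; congr (_ `&` _); apply/seteqP; split=> z.
  by move=> Gz; have [?|?] := pselect (ball_layer X pr m k z); [left|right].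
by move=> [/ball_layerS//|[]].
Qed.

Theorem balanced_measures_eq (A : set B) : measurable A -> A `<=` X -> mu A = nu A.
Proof.
move=> mA AX; suff : diff A = 0.
  move=> /eqP; rewrite subr_eq0 => /eqP dA.
  by rewrite -(fineK (finite_fin_num mu_fin mA)) dA fineK// finite_fin_num.
apply/eqP; rewrite -normr_eq0 eq_le normr_ge0 andbT.
apply/ler_addgt0Pr => e e0; rewrite add0r; have [k Hk] := tail_small e0.
have -> : diff A = diff (A `\` ball_layer X pr m k).
  rewrite -[in LHS](setUIDK A (ball_layer X pr m k)) diffU.
  - by rewrite diff_ball0// add0r.
  - exact: measurableI.
  - exact: measurableD.
  - by rewrite /disj_set; apply/eqP/seteqP; split=> // z [[_ Gz] [_]].
rewrite (le_trans (diff_le_total _))// (le_trans _ Hk)//; apply: total_le.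
- exact: measurableD.
- exact: measurableD.
- exact: setSD.
Qed.

End BalancedMeasures.

(** * Piecewise linear cutoffs approximating indicators of rays *)

Definition ramp (R : realType) (a k y : R) : R := Num.max 0 (Num.min 1 (k * (a - y))).

Section Ramp.
Variable R : realType.
Implicit Types a k y : R.

Lemma ramp_ge0 a k y : 0 <= ramp a k y.
Proof. by rewrite le_max lexx. Qed.

Lemma ramp_le1 a k y : ramp a k y <= 1.
Proof. by rewrite ge_max ler01 ge_min lexx. Qed.

Lemma ramp_eq0 a k y : k * (a - y) <= 0 -> ramp a k y = 0.
Proof. by move=> h; apply/max_idPl; rewrite ge_min h orbT. Qed.

Lemma ramp_eq1 a k y : 1 <= k * (a - y) -> ramp a k y = 1.
Proof. by move=> h; rewrite /ramp (min_idPl h); apply/max_idPr. Qed.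

Lemma ramp_continuous a k : continuous (ramp a k).
Proof.
change (continuous (fun y => Num.max 0 (Num.min 1 (k * (a - y))))).
move=> y; apply: (@continuous_max R R (fun=> 0) (fun y => Num.min 1 (k * (a - y)))).
  exact: cvg_cst.
apply: (@continuous_min R R (fun=> 1) (fun y => k * (a - y))); first exact: cvg_cst.
by apply: cvgM; [exact: cvg_cst|apply: cvgB; [exact: cvg_cst|exact: cvg_id]].
Qed.

(** Layer-cake decomposition: [1 - ramp (j + 1) 1 y] is the portion of [y] between the levels [j]
    and [j + 1]. *)
Lemma sum_ramp n y : 0 <= y -> y <= n%:R ->
  \sum_(j < n) (1 - ramp j.+1%:R 1 y) = y.
Proof.
suff H m : 0 <= y -> \sum_(j < m) (1 - ramp j.+1%:R 1 y) = Num.min m%:R y.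
  by move=> y0 yn; rewrite H//; apply/min_idPr.
move=> y0; elim: m => [|m IH]; first by rewrite big_ord0; apply/esym/min_idPl.
rewrite big_ord_recr/= IH -natr1.
have [ym|my] := leP y m%:R.
  by rewrite ramp_eq1; [rewrite subrr addr0; apply/esym/min_idPr|]; lra.
have [ym1|m1y] := leP y (m%:R + 1).
  rewrite /ramp mul1r (_ : Num.min 1 _ = m%:R + 1 - y); last by apply/min_idPr; lra.
  by rewrite (_ : Num.max 0 _ = m%:R + 1 - y); [lra|apply/max_idPr; lra].
by rewrite ramp_eq0; lra.
Qed.

End Ramp.

Lemma compact_bounded (R : realType) (T : topologicalType) (X : set T) (f : T -> R) :
  compact X -> continuous f -> exists2 M, 0 < M & forall x, X x -> `|f x| <= M.
Proof.
move=> cX cf; have [X0|/set0P X0] := eqVneq X set0.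
  by exists 1 => // x; rewrite X0.
have cn : continuous (fun x => `|f x|) by move=> x; apply: cvg_norm; exact: cf.
have [c _ cm] := compact_EVT_max X0 cX (continuous_subspaceT cn).
exists (`|f c| + 1) => [|x Xx]; first by rewrite ltr_wpDl.
by rewrite (le_trans (cm x _))// ?inE// lerDl.
Qed.

(** * Functionals determined by the two projections *)

Section EqualFunctionals.
Variables (R : realType) (T : normedModType R) (X : set T) (pr : bool -> T -> R).
Hypothesis cX : compact X.
Hypothesis cpr : forall c, continuous (pr c).
Hypothesis acyclic : ~ exists n p, alternating_cycle X pr n p.
Hypothesis attained : forall z, X z -> exists k w, reach X pr k [set z] w /\
  forall j w', reach X pr j [set z] w' -> pr false w <= pr false w'.

Local Notation B := (g_sigma_algebraType (@open T)).

Definition represents (P : (T -> R) -> R) (mu : {measure set B -> \bar R}) :=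
  [/\ (mu setT < +oo)%E,
      forall (A : set T) (g : T -> R), continuous g -> (forall x, 0 <= g x) ->
        (forall x, X x -> A x -> 1 <= g x) -> (mu A <= (P g)%:E)%E,
      forall (A : set T) (g : T -> R), continuous g ->
        (forall x, X x -> A x -> g x <= 1) -> (forall x, X x -> ~ A x -> g x <= 0) ->
        ((P g)%:E <= mu A)%E
    & forall (A : set T) (e : R), 0 < e ->
        exists U, [/\ open U, A `<=` U & (mu U <= mu A + e%:E)%E]].

Lemma continuous_comp_pr (u : R -> R) c : continuous u -> continuous (fun x => u (pr c x)).
Proof. by move=> cu x; apply: continuous_comp; [exact: cpr|exact: cu]. Qed.

Lemma open_borel (A : set T) : open A -> measurable (A : set B).
Proof. by move=> oA; exact: sub_sigma_algebra. Qed.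

Lemma ray_open c a : open [set x | pr c x < a].
Proof.
rewrite (_ : [set x | _] = pr c @^-1` [set y | y < a])//.
by apply: open_comp => [x _|]; [exact: cpr|exact: open_lt].
Qed.

Lemma ray_closed c a : closed [set x | pr c x <= a].
Proof.
rewrite (_ : [set x | _] = pr c @^-1` [set y | y <= a])//.
by apply: closed_comp => [x _|]; [exact: cpr|exact: closed_le].
Qed.

(** The open ray is exhausted by the closed rays ending at [a - 1 / (k + 1)]. The ramp of slope
    [k + 1] is 1 on such a closed ray and 0 off the open one, so its value separates the two
    masses. *)
Lemma ray_le P Q mu nu c a : represents P mu -> represents Q nu ->
  (forall k, P (fun x => ramp a k (pr c x)) = Q (fun x => ramp a k (pr c x))) ->
  (mu [set x | (pr c x < a)%R] <= nu [set x | (pr c x < a)%R])%E.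
Proof.
move=> [mufin muge _ _] [nufin _ nule _] PQ.
pose F (k : nat) : set B := [set x | pr c x <= a - k.+1%:R^-1].
have mF k : measurable (F k) by apply: closed_borel; exact: ray_closed.
have UF : \bigcup_k F k = [set x | pr c x < a].
  apply/seteqP; split=> [x [k _ /= /le_lt_trans]|x /= xa].
    by apply; rewrite gtrBl invr_gt0.
  have ax : 0 < a - pr c x by rewrite subr_gt0.
  exists (Num.trunc (a - pr c x)^-1) => //=.
  rewrite /F /= lerBrDr addrC -lerBrDr -[leRHS]invrK lef_pV2 ?posrE ?invr_gt0//.
  exact: ltW (truncnS_gt _).
have ndF : nondecreasing_seq F.
  move=> i j ij; apply/subsetPset => x; rewrite /F /= => /le_trans; apply.
  by rewrite lerD2l lerN2 lef_pV2 ?posrE// ler_nat.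
rewrite -UF.
have : mu \o F @ \oo --> mu (\bigcup_k F k).
  by apply: nondecreasing_cvg_mu => //; exact: bigcupT_measurable.
move=> cvF; rewrite -(cvg_lim _ cvF)//; apply: lime_le.
  by apply/cvg_ex; exists (mu (\bigcup_k F k)).
apply: nearW => k /=; rewrite UF.
apply: (@le_trans _ _ (P (fun x => ramp a k.+1%:R (pr c x)))%:E).
  apply: muge => [|x|x Xx /= Fx].
  - by apply: continuous_comp_pr; exact: ramp_continuous.
  - exact: ramp_ge0.
  - rewrite ramp_eq1// -ler_pdivrMl// mulr1 lerBrDr addrC -lerBrDr; exact: Fx.
rewrite PQ; apply: nule => [|x Xx _|x Xx /= xa].
- by apply: continuous_comp_pr; exact: ramp_continuous.
- exact: ramp_le1.
- by rewrite ramp_eq0// mulr_ge0_le0// subr_le0 leNgt; apply/negP.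
Qed.

Lemma represents_off P mu : positive_functional X P -> represents P mu ->
  forall A : set B, measurable A -> mu (X `&` A) = mu A.
Proof.
move=> [_ PZ _] [_ muge _ _] A mA.
have mX : measurable (X : set B) by exact: compact_borel.
have : (mu (A `\` X) <= 0)%E.
  have P00 : P (fun=> 0) = 0.
    rewrite -[RHS](mul0r (P (fun=> 0))) -PZ; last by move=> x; exact: cvg_cst.
    by congr P; apply/funext => x; rewrite mul0r.
  apply: (@le_trans _ _ (P (fun=> 0))%:E); last by rewrite P00.
  by apply: muge => // [x|x Xx [_]//]; exact: cvg_cst.
rewrite le_eqVlt ltNge measure_ge0 orbF => /eqP A0.
rewrite -[in RHS](setUIDK A X) [RHS]measureU; last 3 first.
- exact: measurableI.
- exact: measurableD.
- by apply/seteqP; split=> // z [[_ ?] [_]].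
transitivity (mu (A `&` X) + 0)%E; first by rewrite adde0 setIC.
congr (_ + _)%E; exact/esym.
Qed.

Lemma represents_cst P mu : represents P mu -> mu X = (P (fun=> 1))%:E.
Proof.
move=> [_ muge mule _]; apply/eqP; rewrite eq_le; apply/andP; split.
  by apply: muge => // x; exact: cvg_cst.
by apply: mule => // x; exact: cvg_cst.
Qed.

(** For [0 <= g <= 1], cut [n * g] into unit slices. [P] of slice [j] is at most the mass of the set
    where [n * g > j], and [Q] of it at least the mass where [n * g > j + 1]; the sum telescopes to
    [n * (P g - Q g) <= mu X] for every [n]. A general [f] is rescaled into [[0, 1]], which is
    harmless since [P 1 = Q 1]. *)
Lemma functional_le P Q mu nu : positive_functional X P -> positive_functional X Q ->
  represents P mu -> represents Q nu ->
  (forall A : set B, measurable A -> A `<=` X -> mu A = nu A) ->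
  forall f, continuous f -> P f <= Q f.
Proof.
move=> pP pQ rP rQ munu.
have mX : measurable (X : set B) by exact: compact_borel.
have cc (a : R) : continuous (fun _ : T => a) by move=> x; exact: cvg_cst.
have [PD PZ P0] := pP; have [QD QZ Q0] := pQ.
have P1 : P (fun=> 1) = Q (fun=> 1).
  by have := munu X mX (@subset_refl _ X); rewrite (represents_cst rP) (represents_cst rQ) => -[].
have le01 (g : T -> R) : continuous g -> (forall x, X x -> 0 <= g x <= 1) -> P g <= Q g.
  move=> cg g01.
  have cng (n : nat) : continuous (fun x => n%:R * g x).
    by move=> x; apply: cvgM; [exact: cc|exact: cg].
  pose th (n j : nat) x := 1 - ramp j.+1%:R 1 (n%:R * g x).
  have cth n j : continuous (th n j).
    move=> x; apply: cvgB; first exact: cc.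
    by apply: (continuous_comp (cng n x)); exact: ramp_continuous.
  pose t (n j : nat) : R := fine (mu (X `&` [set x | j%:R < n%:R * g x])).
  have mt n j : measurable (X `&` [set x | j%:R < n%:R * g x] : set B).
    apply: measurableI => //; apply: open_borel.
    rewrite (_ : [set x | _] = (fun x => n%:R * g x) @^-1` [set y | j%:R < y])//.
    by apply: open_comp => [x _|]; [exact: cng|exact: open_gt].
  have tfin n j : mu (X `&` [set x | j%:R < n%:R * g x]) \is a fin_num.
    have [mufin _ _ _] := rP; rewrite ge0_fin_numE//; apply: le_lt_trans mufin.
    by apply: le_measure; rewrite ?inE.
  have step n j : P (th n j) - Q (th n j) <= t n j - t n j.+1.
    apply: lerB.
      have [_ _ mule _] := rP; rewrite -lee_fin fineK//; apply: mule => //.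
      - by move=> x Xx _; rewrite gerBl ramp_ge0.
      - move=> x Xx xt; rewrite subr_le0 ramp_eq1// mul1r -natr1.
        have : ~ (j%:R < n%:R * g x) by move=> h; apply: xt.
        by move/negP; rewrite -leNgt; lra.
    have [_ nuge _ _] := rQ; rewrite -lee_fin /t fineK// munu//.
    apply: nuge => // [x|x Xx [_ /= xt]]; first by rewrite subr_ge0 ramp_le1.
    by rewrite /th ramp_eq0 ?subr0// mul1r subr_le0 ltW.
  have sumth n : P (fun x => \sum_(j < n) th n j x) = n%:R * P g /\
      Q (fun x => \sum_(j < n) th n j x) = n%:R * Q g.
    have eqX x : X x -> \sum_(j < n) th n j x = n%:R * g x.
      move=> Xx; rewrite /th sum_ramp//; have /andP[g0 g1] := g01 x Xx.
        by rewrite mulr_ge0.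
      by rewrite -[leRHS]mulr1 ler_wpM2l.
    have cs : continuous (fun x => \sum_(j < n) th n j x).
      by apply: sum_continuous => j; exact: cth.
    by split; rewrite -(PZ, QZ)//; apply/eqP; rewrite eq_le;
      apply/andP; split; apply: (le_functional _ _ _ (X := X)) => // x Xx; rewrite eqX.
  have bound n : n%:R * (P g - Q g) <= fine (mu X).
    have [Ps Qs] := sumth n.
    rewrite mulrBr -Ps -Qs (functional_sum PD PZ)// (functional_sum QD QZ)// -sumrB.
    apply: (@le_trans _ _ (\sum_(j < n) (t n j - t n j.+1))).
      by apply: ler_sum => j _; exact: step.
    rewrite -(big_mkord xpredT (fun j => t n j - t n j.+1)).
    rewrite (eq_bigr (fun j => - (t n j.+1 - t n j))); last by move=> j _; rewrite opprB.
    rewrite sumrN telescope_sumr// opprB.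
    have t0 : 0 <= t n n by rewrite fine_ge0.
    have [mufin _ _ _] := rP.
    have : t n 0 <= fine (mu X).
      apply: fine_le => //; last by apply: le_measure; rewrite ?inE.
      by rewrite ge0_fin_numE//; apply: le_lt_trans mufin; apply: le_measure; rewrite ?inE.
    lra.
  rewrite leNgt; apply/negP => QP; have d0 : 0 < P g - Q g by rewrite subr_gt0.
  have := bound (Num.trunc (fine (mu X) / (P g - Q g))).+1.
  by rewrite leNgt -ltr_pdivrMr// truncnS_gt.
move=> f cf; have [M M0 fM] := compact_bounded cX cf.
have cfM : continuous (fun x => f x + M) by move=> x; apply: cvgD; [exact: cf|exact: cc].
have := le01 (fun x => (2 * M)^-1 * (f x + M)).
rewrite PZ// QZ// PD// QD// (functional_cst PZ) (functional_cst QZ) P1.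
rewrite ler_pM2l ?invr_gt0 ?mulr_gt0// lerD2r; apply.
  by move=> x; apply: cvgM; [exact: cc|exact: cfM].
move=> x Xx; have := fM x Xx; rewrite ler_norml => /andP[f1 f2].
rewrite mulr_ge0 ?invr_ge0 ?mulr_ge0 ?(ltW M0)//=; last lra.
by rewrite mulrC ler_pdivrMr ?mulr_gt0// mul1r; lra.
Qed.

Theorem functional_eq P Q : positive_functional X P -> positive_functional X Q ->
  (forall c a k, P (fun x => ramp a k (pr c x)) = Q (fun x => ramp a k (pr c x))) ->
  forall f, continuous f -> P f = Q f.
Proof.
move=> pP pQ PQ.
have [PD PZ P0] := pP; have [QD QZ Q0] := pQ.
have [mu rP] := positive_functional_measure cX PD PZ P0.
have [nu rQ] := positive_functional_measure cX QD QZ Q0.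
have [m [m_inv m_reach m_min]] := orbit_minimum attained.
have mX : measurable (X : set B) by exact: compact_borel.
have mpr c : measurable_fun [set: B] (pr c : B -> measurableTypeR R).
  apply: (measurability _ (measurable_realfun.RGenInftyO.measurableE R)) => _ [_ [a ->] <-].
  by rewrite setTI; apply: open_borel; rewrite set_itvNyo; exact: ray_open.
(* Open rays form a pi-system generating the Borel sets of the line, so agreement on them extends to
   all Borel sets. *)
have marg c (C : set (measurableTypeR R)) : measurable C ->
    pushforward mu (pr c) C = pushforward nu (pr c) C.
  move=> mC.
  pose pm la : {measure set (measurableTypeR R) -> \bar R} :=
    measure_function_pushforward__canonical__measure_function_Measure la (mpr c).
  have mE : @measurable _ (measurableTypeR R) = <<s @measurable_realfun.RGenInftyO.G R >>.
    exact: measurable_realfun.RGenInftyO.measurableE.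
  pose rays k : set (measurableTypeR R) := `]-oo, k%:R[%classic.
  have raysI : setI_closed (@measurable_realfun.RGenInftyO.G R).
    move=> _ _ [a ->] [b ->]; exists (Num.min a b).
    by rewrite !set_itvNyo; apply/seteqP; split=> x; rewrite /= lt_min => /andP.
  have raysG k : @measurable_realfun.RGenInftyO.G R (rays k) by exists k%:R.
  have rays_cover : \bigcup_k rays k = setT.
    apply/seteqP; split=> // x _; exists (Num.trunc x).+1 => //=.
    by rewrite /rays /= in_itv/= truncnS_gt.
  have pmG A : @measurable_realfun.RGenInftyO.G R A -> pm mu A = pm nu A.
    move=> [a ->]; rewrite /= /pushforward set_itvNyo.
    by apply/eqP; rewrite eq_le (ray_le rP rQ)// (ray_le rQ rP).
  have pmfin k : (pm mu (rays k) < +oo)%E.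
    have [mufin _ _ _] := rP; apply: le_lt_trans mufin.
    suff : (mu (pr c @^-1` rays k) <= mu setT)%E by [].
    apply: le_measure; rewrite ?inE// -[X in measurable X]setTI.
    by apply: (mpr) => //; exact: measurable_itv.
  exact: (@measure_unique _ R (measurableTypeR R) _ rays mE raysI raysG rays_cover
    (pm mu) (pm nu) pmG pmfin C mC).
have munu (A : set B) : measurable A -> A `<=` X -> mu A = nu A.
  have [mufin _ _ mureg] := rP; have [nufin _ _ nureg] := rQ.
  apply: (balanced_measures_eq cX cpr acyclic m_inv m_reach m_min mufin nufin mureg nureg).
  move=> c C cC.
  have mC : measurable (C : set (measurableTypeR R)) by exact: measurable_realfun.compact_measurable.
  have mprC : measurable (pr c @^-1` C : set B) by rewrite -[X in measurable X]setTI; exact: mpr.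
  rewrite (represents_off pP rP mprC) (represents_off pQ rQ mprC); exact: marg.
move=> f cf; apply/eqP; rewrite eq_le; apply/andP; split.
  exact: (functional_le pP pQ rP rQ munu).
apply: (functional_le pQ pP rQ rP) => // A mA AX; exact/esym/munu.
Qed.

End EqualFunctionals.

(** * Density of ridge functions on the line *)

Section FiniteDifferences.
Variable R : realType.
Implicit Types (f : R -> R) (h x : R).

Definition fdiff h f x : R := f (x + h) - f x.

Lemma fdiff_newton h f x n :
  f (x + n%:R * h) = \sum_(j < n.+1) 'C(n, j)%:R * iter j (fdiff h) f x.
Proof.
elim: n f => [|n IH] f.
  by rewrite mul0r addr0 big_ord1 bin0 mul1r.
have -> : f (x + n.+1%:R * h) = f (x + n%:R * h) + fdiff h f (x + n%:R * h).
  by rewrite /fdiff subrKC -addrA -natr1 mulrDl mul1r.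
rewrite !IH big_ord_recl [in RHS]big_ord_recl !bin0 -addrA; congr (_ + _).
under [X in _ + X]eq_bigr do rewrite -iterSr.
rewrite [in RHS]big_ord_recr/= big_ord_recr/= !binn addrA; congr (_ + _).
rewrite -big_split/=; apply: eq_bigr => j _.
by rewrite /bump add1n binS natrD mulrDl.
Qed.

Definition binomial_poly (j : nat) : {poly R} :=
  (j`!%:R^-1) *: \prod_(i < j) ('X - i%:R%:P).

Lemma binomial_polyE j n : (binomial_poly j).[n%:R] = 'C(n, j)%:R.
Proof.
have E : (\prod_(i < j) ('X - i%:R%:P)).[n%:R] = (n ^_ j)%:R :> R.
  elim: j => [|j IH]; first by rewrite big_ord0 hornerC.
  rewrite big_ord_recr/= hornerM IH ffactnSr natrM !hornerE.
  have [jn|nj] := leqP j n; first by rewrite natrB.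
  by rewrite ffact_small// !mul0r.
rewrite hornerZ E -bin_ffact natrM mulrC mulfK// pnatr_eq0 -lt0n fact_gt0.
Qed.

Lemma poly_eq_nat (p q : {poly R}) : (forall n : nat, p.[n%:R] = q.[n%:R]) -> p = q.
Proof.
move=> pq; apply/eqP; rewrite -subr_eq0; apply/negPn/negP => d0.
set s := [seq (i%:R : R) | i <- iota 0 (size (p - q))].
have sroot : all (root (p - q)) s.
  by apply/allP => _ /mapP[i _ ->]; rewrite /root hornerD hornerN pq subrr.
have suniq : uniq s.
  by rewrite map_inj_uniq ?iota_uniq// => i j /eqP; rewrite eqr_nat => /eqP.
by have := max_poly_roots d0 sroot suniq; rewrite size_map size_iota ltnn.
Qed.

(* Newton's formula gives a polynomial on every arithmetic progression; all of
   them agree since any two share infinitely many points with the integers. *)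
Lemma fdiff0_polynomial m f : continuous f -> (forall h x, iter m (fdiff h) f x = 0) ->
  exists q : {poly R}, forall x, f x = q.[x].
Proof.
move=> cf f0.
have f0' j h x : (m <= j)%N -> iter j (fdiff h) f x = 0.
  move=> mj; rewrite -(subnK mj) iterD (_ : iter m _ f = fun=> 0); last first.
    by apply/funext => y; exact: f0.
  elim: (j - m)%N x => [//|k IH] x; by rewrite iterS {1}/fdiff !IH subrr.
have grid x0 h : h != 0 -> exists q : {poly R}, forall n, f (x0 + n%:R * h) = q.[x0 + n%:R * h].
  move=> h0; pose q := \sum_(j < m) (iter j (fdiff h) f x0) *: binomial_poly j.
  exists (q \Po (h^-1 *: ('X - x0%:P))) => n; rewrite horner_comp !hornerE.
  have -> : h^-1 * (x0 + n%:R * h - x0) = n%:R by field.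
  rewrite fdiff_newton horner_sum.
  under [RHS]eq_bigr do rewrite hornerZ binomial_polyE mulrC.
  pose F j := 'C(n, j)%:R * iter j (fdiff h) f x0.
  rewrite -(big_mkord xpredT F) -[RHS](big_mkord xpredT F).
  have [mn|nm] := leqP m n.+1.
    rewrite (big_cat_nat (leq0n m) mn)/= [X in _ + X]big_nat_cond [X in _ + X]big1 ?addr0// => j.
    by case/andP => /andP[mj _] _; rewrite /F f0' ?mulr0.
  rewrite [RHS](big_cat_nat (leq0n n.+1) (ltnW nm))/= [X in _ = _ + X]big_nat_cond [X in _ = _ + X]big1 ?addr0// => j.
  by case/andP => /andP[nj _] _; rewrite /F bin_small ?mul0r.
have [q fq] := grid 0 1 (oner_neq0 _).
have fqn (n : nat) : f n%:R = q.[n%:R] by have := fq n; rewrite mulr1 add0r.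
exists q.
(* The progression from [- M] with step [1 / (N + 1)] contains each natural number [n], at index
   [(n + M) * (N + 1)], so its polynomial is [q]. Together these progressions are dense. *)
have fqr (M N k : nat) : f (- M%:R + k%:R * N.+1%:R^-1) = q.[- M%:R + k%:R * N.+1%:R^-1].
  have N0 : N.+1%:R != 0 :> R by rewrite pnatr_eq0.
  have [q' fq'] := grid (- M%:R) N.+1%:R^-1 (invr_neq0 N0).
  rewrite fq'; congr (_.[_]); apply: poly_eq_nat => n; rewrite -fqn.
  have := fq' ((n + M) * N.+1)%N; rewrite natrM mulfK// natrD addrC addrK.
  by move->.
move=> x; apply/eqP; rewrite -subr_eq0; apply/negPn/negP => d0.
have cg : {for x, continuous (fun y => f y - q.[y])}.
  by apply: cvgB; [exact: cf|exact: continuous_horner].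
have /nbhs_ballP[e /= e0 eg] : \forall y \near x, 0 < `|f y - q.[y]|.
  have : (fun y => `|f y - q.[y]|) y @[y --> x] --> `|f x - q.[x]|.
    by apply: cvg_norm; exact: cg.
  by move=> /cvgr_gt; apply; rewrite normr_gt0.
pose M := (Num.trunc `|x|).+1; pose N := Num.trunc e^-1.
have xM : 0 < M%:R + x.
  by have := truncnS_gt `|x|; have := ler_norm (- x); rewrite normrN /M; lra.
pose k := Num.trunc ((M%:R + x) * N.+1%:R).
have N0 : 0 < N.+1%:R :> R by rewrite ltr0n.
have kle : k%:R <= (M%:R + x) * N.+1%:R by rewrite truncn_le// mulr_ge0 ?ltW.
have klt : (M%:R + x) * N.+1%:R < k%:R + 1 by rewrite natr1 truncnS_gt.
have /eg : ball x e (- M%:R + k%:R * N.+1%:R^-1).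
  rewrite -ball_normE /=.
  have -> : x - (- M%:R + k%:R * N.+1%:R^-1) = ((M%:R + x) * N.+1%:R - k%:R) / N.+1%:R.
    by rewrite [in RHS]mulrBl mulfK ?gt_eqF// opprD opprK addrA (addrC x).
  rewrite ger0_norm ?divr_ge0 ?subr_ge0 ?(ltW N0)//.
  rewrite (@lt_trans _ _ N.+1%:R^-1)//.
    by rewrite ltr_pdivrMr// mulVf ?gt_eqF//; lra.
  by rewrite -[ltRHS]invrK ltf_pV2 ?posrE ?invr_gt0// truncnS_gt.
by rewrite fqr subrr normr0 ltxx.
Qed.

End FiniteDifferences.

Lemma heine_segment (R : realType) (f : R -> R) (A eta : R) : continuous f -> 0 < eta ->
  exists2 d, 0 < d & forall x y, `|x| <= A -> `|x - y| <= d -> `|f x - f y| <= eta.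
Proof.
move=> cf eta0.
have /compact_near_coveringP cA : compact `[- A, A]%classic by exact: segment_compact.
have e2 : 0 < eta / 2 by rewrite divr_gt0.
have [x Ax|d /= d0 H] := cA R 0^'+ (fun d x => forall y, `|x - y| <= d -> `|f x - f y| <= eta) _.
  have /cvgrPdist_lt /(_ _ e2) /nbhs_ballP[r /= r0 rf] := cf x.
  have r2 : 0 < r / 2 by rewrite divr_gt0.
  exists (ball x (r / 2), [set d | d < r / 2]).
    by split; [exact: nbhsx_ballx|exact: nbhs_right_lt].
  move=> [z d] /= [xz dr] y zy.
  have fz : `|f x - f z| < eta / 2.
    by apply: rf; apply: le_ball xz; lra.
  have fy : `|f x - f y| < eta / 2.
    apply: rf; move: xz; rewrite -!ball_normE /= => xz.
    by rewrite -(subrKA z) (le_lt_trans (ler_normD _ _))//; lra.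
  by rewrite -(subrKA (f x)) (le_trans (ler_normD _ _))// (distrC (f z)); lra.
exists (d / 2) => [|x y Ax xy]; first by rewrite divr_gt0.
apply: (H (d / 2)) => //=.
- rewrite /ball_ /= sub0r normrN gtr0_norm ?divr_gt0//.
  lra.
- by rewrite divr_gt0.
- by rewrite in_itv/= -ler_norml.
Qed.

(** By the mean value theorem the error is [k] times an increment of [f], which uniform continuity
    bounds independently of [b]. Integrating over [[- (A + 1), A + 1]] keeps the endpoints of
    [[- A, A]] interior. *)
Lemma antiderivative (R : realType) (f : R -> R) (A : R) : continuous f ->
  exists F : R -> R, forall eta, 0 < eta -> exists2 d, 0 < d &
    forall b k, `|b| <= A -> `|b + k| <= A -> `|k| <= d ->
      `|F (b + k) - F b - k * f b| <= eta * `|k|.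
Proof.
move=> cf; have [A0|A0] := ltP A 0.
  exists f => eta eta0; exists 1 => // b k bA.
  by have := normr_ge0 b; lra.
pose F (x : R) : R := (\int[lebesgue_measure]_(t in `[- (A + 1), x]) f t)%R.
have dF (x : R) : `|x| <= A -> is_derive x (1 : R) F (f x).
  rewrite ler_norml => /andP[x1 x2].
  have xu : x < A + 1 by lra.
  have ax : - (A + 1) < x by lra.
  have fi : lebesgue_measure.-integrable `[- (A + 1), A + 1] (EFin \o f).
    apply: continuous_compact_integrable; first exact: segment_compact.
    exact: continuous_subspaceT.
  have [dF F'] := continuous_FTC1_closed xu fi ax (cf x).
  by apply: DeriveDef => //; rewrite -derive1E.
exists F => eta eta0; have [d d0 Hd] := heine_segment A cf eta0.
exists d => // b k bA bkA kd.
have incr a c : `|a| <= A -> `|c| <= A -> a <= c ->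
    exists2 z, a <= z <= c & F c - F a = f z * (c - a).
  move=> aA cA ac.
  have inA z : a <= z <= c -> `|z| <= A.
    by move: aA cA; rewrite !ler_norml => /andP[? ?] /andP[? ?] /andP[? ?]; lra.
  have [||z zac Fz] := @MVT_segment R F f a c ac.
  - by move=> z /[!in_itv]/= /andP[? ?]; apply: dF; apply: inA; rewrite !ltW.
  - apply: derivable_within_continuous => z /[!in_itv]/= zac.
    by have := dF z (inA z zac) => -[].
  - by exists z => //; move: zac; rewrite in_itv.
have [k0|k0] := leP 0 k.
  have [|z /andP[bz zb] ->] := incr b (b + k) bA bkA; first by lra.
  rewrite [b + k - b]addrC addKr mulrC -mulrBr normrM mulrC ler_wpM2r//.
  rewrite distrC; apply: Hd => //; move: kd; rewrite !ler_norml => /andP[? ?]; lra.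
have [|z /andP[bz zb] Fz] := incr (b + k) b bkA bA; first by lra.
have -> : F (b + k) - F b - k * f b = k * (f z - f b).
  rewrite -[F (b + k) - F b]opprB Fz; ring.
rewrite normrM mulrC ler_wpM2r//.
rewrite distrC; apply: Hd => //; move: kd; rewrite !ler_norml => /andP[? ?]; lra.
Qed.

Lemma riemann_telescope (R : realType) (F f : R -> R) (eta d A b k : R) (n : nat) :
  (forall b k, `|b| <= A -> `|b + k| <= A -> `|k| <= d ->
      `|F (b + k) - F b - k * f b| <= eta * `|k|) ->
  `|k| <= d -> (forall i : nat, (i <= n)%N -> `|b + i%:R * k| <= A) ->
  `|F (b + n%:R * k) - F b - k * \sum_(i < n) f (b + i%:R * k)| <= n%:R * (eta * `|k|).
Proof.
move=> HF kd; elim: n => [|n IH] HA.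
  by rewrite !mul0r addr0 subrr big_ord0 mulr0 subr0 normr0.
have An := HA n (leqnSn n); have An1 := HA n.+1 (leqnn _).
have E : b + n.+1%:R * k = b + n%:R * k + k by rewrite -natr1 mulrDl mul1r addrA.
rewrite E in An1 *; rewrite big_ord_recr/=.
set S := \sum_(i < n) _; set B := b + n%:R * k.
have -> : F (B + k) - F b - k * (S + f B) =
    (F B - F b - k * S) + (F (B + k) - F B - k * f B) by ring.
rewrite (le_trans (ler_normD _ _))// -natr1 mulrDl mul1r lerD//; last exact: HF.
by apply: IH => i ni; apply: HA; exact: leqW.
Qed.

(** * Linear classes of functions closed under uniform limits on a segment *)

Section ClosedClass.
Variables (R : realType) (r : R) (V : set (R -> R)).
Hypothesis r0 : 0 <= r.
Hypothesis VD : forall u v, V u -> V v -> V (fun x => u x + v x).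
Hypothesis VZ : forall c u, V u -> V (fun x => c * u x).
Hypothesis V0 : V (fun=> 0).
Hypothesis Vlim : forall u : R -> R, continuous u ->
  (forall e, 0 < e -> exists2 v, V v & forall x, `|x| <= r -> `|u x - v x| <= e) -> V u.

Let Vsum (n : nat) (F : nat -> R -> R) : (forall i, V (F i)) ->
  V (fun x => \sum_(i < n) F i x).
Proof.
move=> VF; elim: n => [|n IH].
  by rewrite (_ : (fun x => _) = fun=> 0)//; apply/funext => x; rewrite big_ord0.
rewrite (_ : (fun x => _) = fun x => \sum_(i < n) F i x + F n x); first exact: VD.
by apply/funext => x; rewrite big_ord_recr.
Qed.

Let Vm (m : nat) (f : R -> R) := forall t y, V (fun x => x ^+ m * f (t * x + y)).

Let affine_continuous (f : R -> R) (t y : R) : continuous f -> continuous (fun x => f (t * x + y)).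
Proof.
move=> cf x; apply: (@continuous_comp _ _ _ (fun x => t * x + y)); last exact: cf.
apply: cvgD; last exact: cvg_cst.
by apply: cvgM; [exact: cvg_cst|exact: cvg_id].
Qed.

Let exp_continuous m : continuous (fun x : R => x ^+ m).
Proof. by move=> x; exact: exprn_continuous. Qed.

Lemma fdiff_continuous h (f : R -> R) : continuous f -> continuous (fdiff h f).
Proof.
move=> cf x; apply: cvgB; last exact: cf.
have := @affine_continuous f 1 h cf x.
by rewrite (_ : (fun x => f (1 * x + h)) = fun x => f (x + h))//; apply/funext => y; rewrite mul1r.
Qed.

(* With [F' = f], the double difference of [F] over steps [s * x] and [h] is
   both close to [s * x * fdiff h f] and to a Riemann sum of values that the
   class controls: this realizes differentiation in the dilation parameter. *)
Let Vm_step m h (f : R -> R) : continuous f -> Vm m f -> Vm m.+1 (fdiff h f).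
Proof.
move=> cf Vf t y; apply: Vlim => [x|e e0].
  apply: cvgM; first exact: exp_continuous.
  by apply: affine_continuous; exact: fdiff_continuous.
pose A := (`|t| + 1) * r + `|y| + `|h|.
have [F HF] := antiderivative A cf.
have rm0 (k : nat) : 0 <= r ^+ k by rewrite exprn_ge0.
(* [eta1] and [eta2] are such that, after multiplication by [r ^+ m / s], each of the two errors is
   at most [e / 2]. As [eta2] involves [s], the dilation step is fixed before the number [N] of
   translation steps. *)
pose eta1 := e / (4 * (r ^+ m.+1 + 1)).
have eta1_gt0 : 0 < eta1 by rewrite divr_gt0// mulr_gt0// ltr_wpDl.
have [d1 d1_gt0 Hd1] := HF eta1 eta1_gt0.
pose s := Num.min 1 (d1 / (r + 1)).
have r1 : 0 < r + 1 by rewrite ltr_wpDl.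
have s0 : 0 < s by rewrite lt_min ltr01 divr_gt0.
have s1 : s <= 1 by rewrite ge_min lexx.
have sr : s * r <= d1.
  rewrite (@le_trans _ _ (d1 / (r + 1) * r))//.
    by rewrite ler_wpM2r// ge_min lexx orbT.
  by rewrite mulrAC ler_pdivrMr// ler_pM2l// lerDl.
pose eta2 := e * s / (4 * (r ^+ m * `|h| + 1)).
have K0 : 0 < r ^+ m * `|h| + 1 by rewrite ltr_wpDl// mulr_ge0.
have eta2_gt0 : 0 < eta2 by rewrite divr_gt0 ?mulr_gt0.
have [d2 d2_gt0 Hd2] := HF eta2 eta2_gt0.
pose N := (Num.trunc (`|h| / d2)).+1.
have N0 : 0 < N%:R :> R by rewrite ltr0n.
have hN : `|h / N%:R| <= d2.
  rewrite normrM normfV [`|N%:R|]ger0_norm// ler_pdivrMr// mulrC -ler_pdivrMr//.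
  exact: ltW (truncnS_gt _).
pose k := h / N%:R.
have Nk : N%:R * k = h by rewrite mulrC divfK// gt_eqF.
(* A Riemann sum, over translations from 0 to [h], of difference quotients in the dilation. *)
pose v x := \sum_(i < N) (k / s) * (x ^+ m * f ((t + s) * x + (y + i%:R * k)) +
                         (-1) * (x ^+ m * f (t * x + (y + i%:R * k)))).
exists v.
  apply: (Vsum N (F := fun i x => (k / s) * (x ^+ m * f ((t + s) * x + (y + i%:R * k)) +
                         (-1) * (x ^+ m * f (t * x + (y + i%:R * k)))))) => i.
  by apply: VZ; apply: VD; [exact: Vf|apply: VZ; exact: Vf].
move=> x xr; pose a := t * x + y.
have boundA (c q : R) : `|c| <= 1 -> 0 <= q <= 1 -> `|a + c * (s * x) + q * h| <= A.
  move=> c1 /andP[q0 q1]; rewrite /a /A.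
  rewrite (le_trans (ler_normD _ _))// lerD//; last first.
    by rewrite normrM ler_piMl// ger0_norm.
  rewrite addrAC (le_trans (ler_normD _ _))// lerD//.
  rewrite (le_trans (ler_normD _ _))// mulrDl mul1r !normrM lerD//.
    by rewrite ler_wpM2l.
  rewrite (ger0_norm (ltW s0)) mulrA -[leRHS]mul1r ler_pM// ?mulr_ge0 ?(ltW s0)//.
  by rewrite -[leRHS]mul1r ler_pM// ltW.
have sxd : `|s * x| <= d1.
  by rewrite normrM (ger0_norm (ltW s0)) (le_trans _ sr)// ler_wpM2l// ltW.
pose S (b : R) := \sum_(i < N) f (b + i%:R * k).
pose D := F (a + h + s * x) - F (a + h) - (F (a + s * x) - F a).
have D1 : `|D - s * x * (f (a + h) - f a)| <= 2 * (eta1 * (s * r)).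
  have -> : D - s * x * (f (a + h) - f a) =
      (F (a + h + s * x) - F (a + h) - s * x * f (a + h)) -
      (F (a + s * x) - F a - s * x * f a) by rewrite /D; ring.
  have sxr : eta1 * `|s * x| <= eta1 * (s * r).
    by rewrite ler_wpM2l ?(ltW eta1_gt0)// normrM (ger0_norm (ltW s0)) ler_wpM2l// ltW.
  rewrite (le_trans (ler_normB _ _))// mulrDl mul1r lerD// (le_trans _ sxr)//.
    apply: Hd1 => //.
      have := boundA 0 1; rewrite mul0r mul1r addr0; apply; first by rewrite normr0.
      by rewrite ler01 lexx.
    have := boundA 1 1; rewrite !mul1r addrAC; apply; first by rewrite normr1.
    by rewrite ler01 lexx.
  apply: Hd1 => //.
    have := boundA 0 0; rewrite !mul0r !addr0; apply; first by rewrite normr0.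
    by rewrite ler01 lexx.
  have := boundA 1 0; rewrite mul1r mul0r addr0; apply; first by rewrite normr1.
  by rewrite ler01 lexx.
have qN (i : nat) : (i <= N)%N -> 0 <= (i%:R / N%:R : R) <= 1.
  move=> iN; apply/andP; split; first by rewrite divr_ge0// ltW.
  by rewrite ler_pdivrMr// mul1r ler_nat.
have D2 : `|D - k * (S (a + s * x) - S a)| <= 2 * (eta2 * `|h|).
  have Nhk : N%:R * (eta2 * `|k|) = eta2 * `|h|.
    by rewrite mulrCA -[N%:R]ger0_norm// -normrM Nk.
  have T1 := riemann_telescope (b := a + s * x) (n := N) Hd2 hN.
  have T2 := riemann_telescope (b := a) (n := N) Hd2 hN.
  rewrite -/k Nk Nhk in T1 T2.
  have -> : D - k * (S (a + s * x) - S a) =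
      (F (a + s * x + h) - F (a + s * x) - k * S (a + s * x)) -
      (F (a + h) - F a - k * S a) by rewrite /D (addrAC a h); ring.
  rewrite (le_trans (ler_normB _ _))// mulrDl mul1r lerD//.
    apply: T1 => i iN; have := boundA 1 (i%:R / N%:R); rewrite !mul1r mulrAC -mulrA.
    by apply; [rewrite normr1|exact: qN].
  apply: T2 => i iN; have := boundA 0 (i%:R / N%:R); rewrite !mul0r addr0 mulrAC -mulrA.
  by apply; [rewrite normr0|exact: qN].
have vE : v x = x ^+ m / s * (k * (S (a + s * x) - S a)).
  rewrite /v /S -sumrB !mulr_sumr; apply: eq_bigr => i _.
  have -> : (t + s) * x + (y + i%:R * k) = a + s * x + i%:R * k by rewrite /a; ring.
  have -> : t * x + (y + i%:R * k) = a + i%:R * k by rewrite /a; ring.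
  ring.
have uE : x ^+ m.+1 * fdiff h f (t * x + y) = x ^+ m / s * (s * x * (f (a + h) - f a)).
  by rewrite /fdiff -/a exprS; field; rewrite gt_eqF.
rewrite uE vE -mulrBr normrM.
have xm : `|x ^+ m / s| <= r ^+ m / s.
  rewrite normrM normrX normfV (ger0_norm (ltW s0)) ler_wpM2r ?invr_ge0 ?(ltW s0)//.
  by rewrite lerXn2r// nnegrE.
have : `|s * x * (f (a + h) - f a) - k * (S (a + s * x) - S a)| <=
    2 * (eta1 * (s * r)) + 2 * (eta2 * `|h|).
  rewrite -[X in `|X|](subrKA D) (le_trans (ler_normD _ _))// lerD//.
  by rewrite distrC.
move=> H; rewrite (le_trans (ler_pM _ _ xm H))//.
have -> : r ^+ m / s * (2 * (eta1 * (s * r)) + 2 * (eta2 * `|h|)) =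
   (e / 2) * (r ^+ m.+1 / (r ^+ m.+1 + 1)) + (e / 2) * (r ^+ m * `|h| / (r ^+ m * `|h| + 1)).
  rewrite /eta1 /eta2 exprS; field.
  by rewrite !gt_eqF//= -exprS ltr_wpDl.
have q1 (z : R) : 0 <= z -> z / (z + 1) <= 1.
  by move=> z0; rewrite ler_pdivrMr ?ltr_wpDl// mul1r lerDl.
have := q1 _ (rm0 m.+1); have := q1 _ (mulr_ge0 (rm0 m) (normr_ge0 h)).
set X := _ / _; set Y := _ / _ => X1 Y1.
have : (e / 2) * Y <= e / 2 by rewrite ger_pMr ?divr_gt0.
have : (e / 2) * X <= e / 2 by rewrite ger_pMr ?divr_gt0.
lra.
Qed.

Let iter_fdiff_continuous m h (f : R -> R) : continuous f -> continuous (iter m (fdiff h) f).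
Proof. by move=> cf; elim: m => [//|m IH]; exact: fdiff_continuous. Qed.

Variable sigma : R -> R.
Hypothesis csigma : continuous sigma.
Hypothesis sigma_npoly : ~ exists q : {poly R}, forall x, sigma x = q.[x].
Hypothesis Vsigma : forall t y, V (fun x => sigma (t * x + y)).

(** With dilation 0 the argument of [sigma] is constant, so the class contains [x ^+ m] times any
    value of an [m]-th difference of [sigma]. If all these values vanished, [sigma] would be a
    polynomial. *)
Lemma class_monomial m : V (fun x => x ^+ m).
Proof.
have Vi h j : Vm j (iter j (fdiff h) sigma).
  elim: j => [t y|k IH].
    rewrite (_ : (fun x => _) = fun x => sigma (t * x + y))//.
    by apply/funext => x; rewrite expr0 mul1r.
  by apply: Vm_step IH; exact: iter_fdiff_continuous.
apply: contrapT => Vnm; apply: sigma_npoly.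
apply: (fdiff0_polynomial (m := m) csigma) => h x.
apply: contrapT => /eqP c0; apply: Vnm; set c := iter _ _ _ _ in c0.
rewrite (_ : (fun x => _) = fun z => c^-1 * (z ^+ m * iter m (fdiff h) sigma (0 * z + x))).
  by apply: VZ; exact: Vi.
by apply/funext => z; rewrite mul0r add0r -/c mulrC mulfK.
Qed.

Lemma class_poly (p : {poly R}) : V (fun x => p.[x]).
Proof.
rewrite (_ : (fun x => _) = fun x => \sum_(i < size p) p`_i * x ^+ i).
  by apply: (Vsum _ (F := fun i x => p`_i * x ^+ i)) => i; apply: VZ; exact: class_monomial.
by apply/funext => x; rewrite horner_coef.
Qed.

(** The classical iteration for the square root of [y ^ 2], converging to [|y|] on [[-1, 1]]. *)
Let abs_poly (n : nat) : {poly R} :=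
  iter n (fun p => p + 2^-1 *: ('X^2 - p ^+ 2)) 0.

(** The third bound gives a uniform error of at most [2 / n]. With [z = |y|], one step multiplies
    the error by [1 - (z + p) / 2 <= 1 - z / 2], and [(1 - z / 2) * (1 + (n + 1) * z / 2) <= 1 + n *
    z / 2]. *)
Let abs_polyE n y : `|y| <= 1 -> [/\ 0 <= (abs_poly n).[y], (abs_poly n).[y] <= `|y| &
   (`|y| - (abs_poly n).[y]) * (1 + n%:R * (`|y| / 2)) <= `|y|].
Proof.
move=> y1; elim: n => [|n [p0 py IH]].
  by rewrite horner0 mul0r addr0 subr0 mulr1.
have -> : (abs_poly n.+1).[y] = (abs_poly n).[y] + 2^-1 * (y ^+ 2 - (abs_poly n).[y] ^+ 2).
  by rewrite [abs_poly n.+1]/(abs_poly n + 2^-1 *: ('X^2 - abs_poly n ^+ 2)) !hornerE.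
set p := (abs_poly n).[y] in p0 py IH *.
have -> : y ^+ 2 = `|y| ^+ 2 by rewrite real_normK// num_real.
set z := `|y| in y1 py IH *; have z0 : 0 <= z by rewrite normr_ge0.
have E : z - (p + 2^-1 * (z ^+ 2 - p ^+ 2)) = (z - p) * (1 - (z + p) / 2) by field.
split.
- by rewrite addr_ge0// mulr_ge0// subr_ge0 lerXn2r// nnegrE.
- by rewrite -subr_ge0 E mulr_ge0//; lra.
- have n0 : 0 <= n%:R :> R by [].
  have t0 : 0 <= n%:R * (z / 2) by rewrite mulr_ge0//; lra.
  have key : (1 - (z + p) / 2) * (1 + n.+1%:R * (z / 2)) <= 1 + n%:R * (z / 2).
    have -> : n.+1%:R * (z / 2) = n%:R * (z / 2) + z / 2 by rewrite -natr1 mulrDl mul1r.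
    rewrite (@le_trans _ _ ((1 - z / 2) * (1 + (n%:R * (z / 2) + z / 2))))//.
      by rewrite ler_wpM2r//; lra.
    rewrite -subr_ge0.
    have -> : 1 + n%:R * (z / 2) - (1 - z / 2) * (1 + (n%:R * (z / 2) + z / 2)) =
       (z / 2) * (n%:R * (z / 2)) + (z / 2) * (z / 2) by ring.
    by rewrite addr_ge0// mulr_ge0//; lra.
  have zp0 : 0 <= z - p by rewrite subr_ge0.
  rewrite E; move: key IH; set w := n.+1%:R => key IH.
  have : (z - p) * ((1 - (z + p) / 2) * (1 + w * (z / 2))) <=
    (z - p) * (1 + n%:R * (z / 2)) by rewrite ler_wpM2l.
  lra.
Qed.

Lemma class_abs_affine c d : V (fun x => `|c * x + d|).
Proof.
apply: Vlim => [x|e e0].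
  apply: cvg_norm; apply: cvgD; last exact: cvg_cst.
  by apply: cvgM; [exact: cvg_cst|exact: cvg_id].
pose M := `|c| * r + `|d| + 1.
have M0 : 0 < M by rewrite ltr_wpDl// addr_ge0// mulr_ge0.
have [n n0 Mn] : exists2 n, 0 < n%:R :> R & 2 * M <= e * n%:R.
  exists (Num.trunc (2 * M / e)).+1; first by rewrite ltr0n.
  by rewrite -ler_pdivrMl// mulrC; exact: ltW (truncnS_gt _).
exists (fun x => M * (abs_poly n \Po (M^-1 *: (c *: 'X + d%:P))).[x]).
  by apply: VZ; exact: class_poly.
move=> x xr; rewrite horner_comp !hornerE.
set y := M^-1 * (c * x + d).
have cxd : c * x + d = M * y by rewrite mulrA divff ?gt_eqF// mul1r.
have y1 : `|y| <= 1.
  rewrite normrM normfV (ger0_norm (ltW M0)) mulrC ler_pdivrMr// mul1r.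
  rewrite (le_trans (ler_normD _ _))// /M normrM.
  by have := ler_wpM2l (normr_ge0 c) xr; rewrite /=; lra.
have [p0 py pn] := abs_polyE n y1.
rewrite cxd normrM (ger0_norm (ltW M0)) -mulrBr normrM (ger0_norm (ltW M0)).
rewrite ger0_norm ?subr_ge0//.
set p := (abs_poly n).[y] in p0 py pn *; set z := `|y| in y1 py pn *.
have z0 : 0 <= z by exact: normr_ge0.
have : (z - p) * n%:R <= 2.
  have [zE|z_gt0] := eqVneq z 0; first by rewrite zE in py *; have -> : p = 0; lra.
  have {}z_gt0 : 0 < z by rewrite lt_neqAle eq_sym z_gt0.
  rewrite -(ler_pM2l z_gt0).
  have : 0 <= z - p by lra.
  by move: pn; lra.
move=> H; have H' : M * ((z - p) * n%:R) <= M * 2 by rewrite ler_pM2l.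
rewrite -(ler_pM2r n0); move: H' Mn; set N := n%:R; lra.
Qed.

(** With [z = k * (a - x)], the truncation to [[0, 1]] is [(1 + |z| - |z - 1|) / 2]. *)
Lemma class_ramp a k : V (ramp a k).
Proof.
rewrite (_ : ramp a k = fun x => 2^-1 * ((1 + `|(- k) * x + k * a|) +
    (-1) * `|(- k) * x + (k * a - 1)|)).
  apply: VZ; apply: VD; last by apply: VZ; exact: class_abs_affine.
  apply: VD; last exact: class_abs_affine.
  by rewrite (_ : (fun=> 1) = fun x => x ^+ 0); [exact: class_monomial|apply/funext].
apply/funext => x; have zE : k * (a - x) = - k * x + k * a by ring.
have -> : - k * x + (k * a - 1) = (- k * x + k * a) - 1 by ring.
rewrite -zE; set z := k * (a - x).
have [z1|z1] := leP 1 z.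
  rewrite ramp_eq1// !ger0_norm ?subr_ge0//; first by field.
  exact: le_trans z1.
have [z0|z0] := leP 0 z.
  rewrite /ramp -/z (_ : Num.min 1 z = z); last by apply/min_idPr; exact: ltW.
  rewrite (_ : Num.max 0 z = z); last exact/max_idPr.
  by rewrite ger0_norm// ltr0_norm ?subr_lt0//; field.
rewrite ramp_eq0 ?ltW// !ltr0_norm ?subr_lt0//; first by field.
Qed.

End ClosedClass.

(** * Paths, orbits and ridge functions *)

Section PathsAndReach.
Variables (R : realType) (d : nat) (a1 a2 : 'rV[R]_d) (X : set 'rV[R]_d).

Definition direction (c : bool) : 'rV[R]_d -> R := dotv (if c then a2 else a1).

Lemma direction_continuous c : continuous (direction c).
Proof.
apply: (sum_continuous (F := fun i (x : 'rV[R]_d) => (if c then a2 else a1) 0 i * x 0 i)).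
move=> i x; apply: (@continuousM R 'rV[R]_d (fun=> _) (fun x => x 0 i) x).
  exact: cst_continuous.
exact: coord_continuous.
Qed.

(** Here [n] counts steps, so there are [n + 1] points; [c] is the direction of the first step. *)
Definition alternating_path (c : bool) (n : nat) (p : nat -> 'rV[R]_d) :=
  [/\ forall i, (i <= n)%N -> X (p i), forall i, (i < n)%N -> p i <> p i.+1
    & forall i, (i < n)%N -> direction (c (+) odd i) (p i) = direction (c (+) odd i) (p i.+1)].

Lemma alternating_path_is_path c n p :
  alternating_path c n p -> is_path a1 a2 X (Some n.+1) p.
Proof.
move=> [pX pne pd]; split => //=.
by case: c pd => pd; [right|left] => i /= ni; have := pd i ni; rewrite /direction;
  case: (odd i).
Qed.

Lemma alternating_path_append c n p w : alternating_path c n p -> X w -> p n <> w ->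
  direction (c (+) odd n) (p n) = direction (c (+) odd n) w ->
  alternating_path c n.+1 (fun i => if (i <= n)%N then p i else w).
Proof.
move=> [pX pne pd] Xw pw dw; split => i.
- by case: ifP => // /pX.
- rewrite ltnS => ni; rewrite ni; case: ltnP => [|ni']; first exact: pne.
  by have -> : i = n by apply/eqP; rewrite eqn_leq ni ni'.
- rewrite ltnS => ni; rewrite ni; case: ltnP => [|ni']; first exact: pd.
  by have -> : i = n by apply/eqP; rewrite eqn_leq ni ni'.
Qed.

Lemma alternating_path_take c n k p : (k <= n)%N ->
  alternating_path c n p -> alternating_path c k p.
Proof.
move=> kn [pX pne pd]; split => i ik.
- by apply: pX; exact: leq_trans kn.
- by apply: pne; exact: leq_trans kn.
- by apply: pd; exact: leq_trans kn.
Qed.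

(** Steps of [reach] may stand still or repeat a direction. If the new step has the direction of the
    last one, the last point is dropped and its predecessor is joined to [w] directly, unless it
    already equals [w]. *)
Lemma reach_alternating_path k z w : X z -> reach X direction k [set z] w ->
  exists c n p, [/\ alternating_path c n p, p 0%N = z & p n = w].
Proof.
move=> Xz; elim: k w => [w ->|k IH w [Xw [y /IH[c [n [p [ap p0 pn]]]] [c' wy]]]].
  by exists false, 0%N, (fun=> z); split.
have [yw|/eqP yw] := eqVneq y w; first by exists c, n, p; rewrite -yw.
case: n ap pn => [|n] ap pn.
  exists c', 1%N, (fun i => if (i <= 0)%N then p i else w); split => //.
  have [pX _ _] := ap; apply: alternating_path_append => //.
  - by rewrite pn.
  - by rewrite addbF pn.
have [cE|cE] := eqVneq c' (c (+) odd n.+1).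
  exists c, n.+2, (fun i => if (i <= n.+1)%N then p i else w); split => //.
    by apply: alternating_path_append => //; rewrite pn// -cE.
  by rewrite ltnn.
have {}cE : c' = c (+) odd n by move: cE => /=; case: (c'); case: (c); case: (odd n).
have ap' := alternating_path_take (leqnSn n) ap.
have [pw|/eqP pw] := eqVneq (p n) w; first by exists c, n, p; split.
exists c, n.+1, (fun i => if (i <= n)%N then p i else w); split => //; last by rewrite ltnn.
apply: alternating_path_append => //.
have [_ _ /(_ n (ltnSn n))] := ap.
by rewrite pn -cE => ->.
Qed.

Lemma reach_path_equiv k z w : X z -> reach X direction k [set z] w ->
  path_equiv a1 a2 X z w.
Proof.
move=> Xz /(reach_alternating_path Xz)[c [n [p [ap p0 pn]]]].
exists (Some n.+1), p; split; first exact: alternating_path_is_path ap.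
by split; [exists 0%N|exists n => //=].
Qed.

Lemma path_equiv_reach z w : path_equiv a1 a2 X z w ->
  exists k, reach X direction k [set z] w.
Proof.
move=> [N [p [[N0 pX _ alt] [[i Ni <-] [j Nj <-]]]]].
have in_range_le m n : (m <= n)%N -> in_range N n -> in_range N m.
  by case: N {N0 pX alt Ni Nj} => [N|//] mn /=; exact: leq_ltn_trans.
have step l : in_range N l.+1 -> exists c, direction c (p l.+1) = direction c (p l).
  move=> Nl; have [/(_ l Nl) /= alt'|/(_ l Nl) /= alt'] := alt.
    by exists (odd l); rewrite /direction alt'.
  by exists (~~ odd l); rewrite /direction; case: (odd l) alt' => /= ->.
have fwd l k : in_range N (l + k) -> reach X direction k [set p l] (p (l + k)%N).
  elim: k => [|k IH]; first by rewrite addn0.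
  rewrite addnS => Nlk; have Nlk' := in_range_le _ _ (leqnSn _) Nlk.
  split; first exact: pX.
  by exists (p (l + k)%N); [exact: IH|exact: step].
have [ij|ji] := leqP i j.
  by exists (j - i)%N; have := fwd i (j - i)%N; rewrite subnKC//; exact.
exists (i - j)%N; apply: reach_sym; [exact: pX..|].
by have := fwd j (i - j)%N; rewrite subnKC ?(ltnW ji)//; exact.
Qed.

Lemma path_orbit_sub z : path_orbit a1 a2 X z `<=` X.
Proof. by move=> w [N [p [[_ pX _ _] [_ [j Nj <-]]]]]; exact: pX. Qed.

(** Closedness of the orbits enters here: a closed orbit in [X] is compact, so the first projection
    attains its minimum on it. *)
Lemma orbit_attained : compact X -> (forall x, X x -> closed (path_orbit a1 a2 X x)) ->
  forall z, X z -> exists k w, reach X direction k [set z] w /\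
    forall j w', reach X direction j [set z] w' -> direction false w <= direction false w'.
Proof.
move=> cX cO z Xz.
have cz : compact (path_orbit a1 a2 X z).
  by apply: subclosed_compact cX _; [exact: cO|exact: path_orbit_sub].
have z0 : path_orbit a1 a2 X z !=set0.
  by exists z; exact: (@reach_path_equiv 0).
have [w] := compact_EVT_min z0 cz (continuous_subspaceT (@direction_continuous false)).
rewrite inE => /path_equiv_reach[k zw] wmin; exists k, w; split => // j w' zw'.
by apply: wmin; rewrite inE; exact: reach_path_equiv zw'.
Qed.

Lemma alternating_cycle_closed_path n p :
  alternating_cycle X direction n p -> is_closed_path a1 a2 X n p.
Proof.
move=> [n0 pX pne pd pn].
have n2 : (0 < n.*2)%N by rewrite double_gt0.
have alt i : dotv (if odd i then a2 else a1) (p i) = dotv (if odd i then a2 else a1) (p i.+1).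
  exact: pd.
split; split => //.
- by left=> i _; exact: alt.
- move=> i /=; rewrite ltnS => i2; rewrite modn_small//.
  move: i2; rewrite leq_eqVlt => /orP[/eqP i2E|i2].
    by rewrite i2E modnn -pn -i2E; exact: pne.
  by rewrite modn_small//; exact: pne.
- left=> i /=; rewrite ltnS => i2; rewrite (modn_small i2).
  move: (i2); rewrite leq_eqVlt => /orP[/eqP i2E|i2']; last by rewrite modn_small.
  by rewrite i2E modnn -pn -i2E; exact: alt.
Qed.

Lemma acyclic_directions : ~ has_closed_path a1 a2 X ->
  ~ exists n p, alternating_cycle X direction n p.
Proof.
by move=> H [n [p np]]; apply: H; exists n, p; exact: alternating_cycle_closed_path.
Qed.

Lemma closed_path_alternating_cycle n p : is_closed_path a1 a2 X n p ->
  exists q, alternating_cycle X direction n q.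
Proof.
move=> [[/= n0 pX _ _] [_ _ qne qalt]].
have n2 : (0 < n)%N by rewrite -double_gt0.
pose q i := p (i %% n.*2)%N.
have qS i : q i.+1 = q (i %% n.*2).+1 by rewrite /q; congr p; rewrite -[i.+1]addn1 -modnDml addn1.
have qm i : q i = q (i %% n.*2)%N by rewrite /q modn_mod.
have om i : odd (i %% n.*2) = odd i.
  by rewrite [in RHS](divn_eq i n.*2) oddD oddM odd_double andbF.
have im i : (i %% n.*2 < n.*2)%N by rewrite ltn_mod.
have Xq i : X (q i) by apply: pX; rewrite /= ltn_mod.
have {}qne i : q i <> q i.+1.
  by rewrite qS qm; exact: (qne _ (im i)).
have qper : q n.*2.+1 = q 1%N by rewrite qS modnn.
case: qalt => qalt.
  exists q; split => //; last by rewrite /q modnn mod0n.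
  move=> i; rewrite qS qm -om; exact: (qalt _ (im i)).
(* The path begins along [a2]; starting one point later restores the order of the directions. *)
exists (fun i => q i.+1); split => //.
move=> i; rewrite (qS i.+1) (qm i.+1) -[odd i]negbK -/(odd i.+1) -om.
have := qalt _ (im i.+1); rewrite /direction /=.
by case: (odd (i.+1 %% n.*2)).
Qed.

End PathsAndReach.

(** * Closed paths as annihilating point evaluations *)

Section AnnihilatingCycle.
Variables (R : realType) (T : eqType) (X : set T) (pr : bool -> T -> R).

Lemma alternating_sum0 (e : nat) (g : nat -> R) :
  (forall l, (l < e)%N -> g l.*2 = g l.*2.+1) ->
  \sum_(l < e.*2) (-1) ^+ l * g l = 0.
Proof.
elim: e => [|e IH] ge; first by rewrite big_ord0.
rewrite doubleS !big_ord_recr/= IH => [|l le]; last by apply: ge; exact: ltnW.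
rewrite add0r ge// exprS -signr_odd odd_double expr0; ring.
Qed.

Lemma alternating_sum_cyclic (e : nat) (g : nat -> R) : (0 < e)%N ->
  (forall l, (l.+1 < e)%N -> g l.*2.+1 = g l.*2.+2) -> g e.*2.-1 = g 0%N ->
  \sum_(l < e.*2) (-1) ^+ l * g l = 0.
Proof.
case: e => // e _ ge; rewrite doubleS /= => ge0.
rewrite big_ord_recl big_ord_recr/= expr0 mul1r.
have S0 := @alternating_sum0 e (fun l => g l.+1) ge.
rewrite (eq_bigr (fun l : 'I_e.*2 => - ((-1) ^+ l * g l.+1))); last first.
  by move=> l _; rewrite /bump/= add1n exprS mulN1r mulNr.
rewrite sumrN S0 oppr0 /bump/= add1n exprS -signr_odd odd_double expr0 ge0; ring.
Qed.

(** On an arbitrary cycle a point may recur with opposite signs and the alternating sum may cancel;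
    uniqueness of [a 0] rules this out. For each projection the points pair up on common lines with
    opposite signs, consecutively for one and cyclically for the other. *)
Lemma alternating_cycle_annihilator n p : alternating_cycle X pr n p ->
  exists e (a : nat -> T), [/\ (0 < e)%N, forall l, X (a l),
    forall l, (0 < l < e.*2)%N -> a l <> a 0%N
  & forall (u : R -> R) c, \sum_(l < e.*2) (-1) ^+ l * u (pr c (a l)) = 0].
Proof.
move=> [n0 pX pne pd pn].
(* [line i] is the line through [p i] and [p i.+1]; between two closest equal
   lines the first point cannot reappear. *)
pose line i := (odd i, pr (odd i) (p i)).
have lineE i : line i = (odd i, pr (odd i) (p i.+1)) by rewrite /line pd.
pose Q d := `[< (0 < d)%N /\ exists i, line i = line (i + d)%N >].
have exQ : exists d, Q d.
  exists n.*2; apply/asboolP; split; first by rewrite double_gt0.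
  by exists 0%N; rewrite /line add0n odd_double pn.
case: (ex_minnP exQ) => d /asboolP[d0 [i ij]] dmin.
have {}dmin k l : (k < l)%N -> (l - k < d)%N -> line k <> line l.
  move=> kl ld klE; move: ld; rewrite ltnNge => /negP; apply; apply: dmin.
  by apply/asboolP; split; [rewrite subn_gt0|exists k; rewrite subnKC// ltnW].
have od : ~~ odd d.
  by move: ij => [+ _]; rewrite oddD; case: (odd i); case: (odd d).
have dE : d = d./2.*2 by rewrite halfK (negbTE od) subn0.
have e0 : (0 < d./2)%N by rewrite -double_gt0 -dE.
exists d./2, (fun l => p (i.+1 + l)%N); split => //.
- move=> l /andP[l0]; rewrite -dE => ld; rewrite addn0 => pl.
  (* [line (i + l)] passes through the recurring point, so by its direction it equals [line i.+1] or
     [line i], at an index distance below [d]. *)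
  have lil : line (i + l)%N = (odd (i + l), pr (odd (i + l)) (p i.+1)).
    by rewrite lineE -pl.
  have [ol|ol] := boolP (odd l).
    have l1 : l != 1%N.
      by apply/eqP => l1; move: pl; rewrite l1 addn1 => /esym; exact: pne.
    apply: (dmin i.+1 (i + l)%N).
    + by rewrite -[i.+1]addn1 ltn_add2l ltn_neqAle eq_sym l1.
    + by rewrite -[i.+1]addn1 subnDl (leq_ltn_trans _ ld)// leq_subr.
    + by rewrite lil /line oddD ol addbT.
  apply: (dmin i (i + l)%N).
  + by rewrite -[ltnLHS]addn0 ltn_add2l.
  + by rewrite addnC addnK.
  + by rewrite lil lineE oddD (negbTE ol) addbF.
- move=> u c; have [->|cE] := eqVneq c (odd i).
    apply: (@alternating_sum_cyclic _ (fun l => u (pr (odd i) (p (i.+1 + l)%N)))) => //.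
      move=> l _; congr u; have := pd (i.+1 + l.*2.+1)%N.
      have -> : odd (i.+1 + l.*2.+1) = odd i.
        by rewrite addnS addSn /= oddD odd_double addbF negbK.
      by rewrite -addnS.
    congr u; rewrite -dE addSn -addnS prednK// addn0 -pd.
    by move: ij => [oE ->]; rewrite oE.
  have {}cE : c = ~~ odd i by move: cE; case: (c); case: (odd i).
  apply: (@alternating_sum0 _ (fun l => u (pr c (p (i.+1 + l)%N)))) => l _.
  congr u; have := pd (i.+1 + l.*2)%N.
  have -> : odd (i.+1 + l.*2) = c by rewrite addSn /= oddD odd_double addbF.
  by rewrite -addnS.
Qed.

End AnnihilatingCycle.

Lemma functional_dist (R : realType) (T : normedModType R) (X : set T)
    (P : (T -> R) -> R) (f g : T -> R) e : positive_functional X P ->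
  continuous f -> continuous g -> (forall x, X x -> `|f x - g x| <= e) ->
  `|P f - P g| <= e * P (fun=> 1).
Proof.
move=> [PD PZ P0] cf cg fg.
have cc : continuous (fun _ : T => e) by move=> x; exact: cvg_cst.
have cB (u v : T -> R) : continuous u -> continuous v -> continuous (fun x => u x - v x).
  by move=> cu cv x; apply: cvgB; [exact: cu|exact: cv].
have Pe : P (fun=> e) = e * P (fun=> 1).
  by rewrite -PZ; [congr P; apply/funext => x; rewrite mulr1|move=> x; exact: cvg_cst].
rewrite -Pe ler_norml -lerN2 opprK opprB -!(functionalB PD PZ)//.
have H u v : continuous u -> continuous v -> (forall x, X x -> `|u x - v x| <= e) ->
    P (fun x => u x - v x) <= P (fun=> e).
  move=> cu cv uv; apply: (le_functional PD PZ P0) => //; first exact: cB.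
  by move=> x /uv; exact: le_trans (ler_norm _).
by rewrite !H// => x Xx; rewrite distrC fg.
Qed.

Lemma norm_sub_continuous (R : realType) (T : normedModType R) (a : T) :
  continuous (fun x => `|x - a|).
Proof.
move=> x; apply: cvg_norm; apply: cvgB; [exact: cvg_id|exact: cvg_cst].
Qed.

(** * Ridge functions with weights on two lines *)

Section RidgeFunctions.
Variables (R : realType) (d : nat) (sigma : R -> R) (a1 a2 : 'rV[R]_d).
Hypothesis csigma : continuous sigma.

Local Notation S := (ridge_span sigma (two_lines a1 a2)).

Lemma dotvZ t (a x : 'rV[R]_d) : dotv (t *: a) x = t * dotv a x.
Proof. by rewrite /dotv mulr_sumr; apply: eq_bigr => i _; rewrite mxE mulrA. Qed.

Lemma two_linesP w : two_lines a1 a2 w ->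
  exists c t, forall x, dotv w x = t * direction a1 a2 c x.
Proof.
move=> [[t _ <-]|[t _ <-]]; [exists false, t|exists true, t] => x; exact: dotvZ.
Qed.

Lemma ridge_span_continuous s : S s -> continuous s.
Proof.
move=> [n [c [w [th [Ww ->]]]]]; apply: (sum_continuous
  (F := fun k (x : 'rV[R]_d) => c k * sigma (dotv (w k) x - th k))) => k x.
have [b [t wE]] := two_linesP (Ww k).
apply: (@continuousM R 'rV[R]_d (fun=> c k) (fun x => sigma (dotv (w k) x - th k)) x).
  exact: cst_continuous.
apply: (@continuous_comp _ _ _ (fun x => dotv (w k) x - th k)); last exact: csigma.
have cw : continuous (dotv (w k)).
  rewrite (_ : dotv (w k) = fun y => t * direction a1 a2 b y); last by apply/funext.
  move=> y; apply: (@continuousM R 'rV[R]_d (fun=> t) (direction a1 a2 b) y).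
    exact: cst_continuous.
  exact: direction_continuous.
by apply: (@continuousB R R^o 'rV[R]_d (dotv (w k)) (fun=> th k) x);
  [exact: cw|exact: cst_continuous].
Qed.

Lemma ridge_span0 : S (fun=> 0).
Proof.
exists 0%N, (fun=> 0), (fun=> 0), (fun=> 0); split; first by case.
by apply/funext => x; rewrite big_ord0.
Qed.

Lemma ridge_spanD s t : S s -> S t -> S (fun x => s x + t x).
Proof.
move=> [n [c [w [th [Ww ->]]]]] [m [c' [w' [th' [Ww' ->]]]]].
pose glue (U : Type) (f : 'I_n -> U) (g : 'I_m -> U) (k : 'I_(n + m)) :=
  match fintype.split k with inl i => f i | inr j => g j end.
exists (n + m)%N, (glue _ c c'), (glue _ w w'), (glue _ th th'); split.
  by move=> k; rewrite /glue; case: fintype.split.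
apply/funext => x; rewrite big_split_ord/=; congr (_ + _); apply: eq_bigr => i _.
  by rewrite /glue (unsplitK (inl i)).
by rewrite /glue (unsplitK (inr i)).
Qed.

Lemma ridge_spanZ a s : S s -> S (fun x => a * s x).
Proof.
move=> [n [c [w [th [Ww ->]]]]]; exists n, (fun k => a * c k), w, th; split => //.
by apply/funext => x; rewrite mulr_sumr; apply: eq_bigr => k _; rewrite mulrA.
Qed.

Lemma ridge_span_direction c t y : S (fun x => sigma (t * direction a1 a2 c x + y)).
Proof.
exists 1%N, (fun=> 1), (fun=> t *: (if c then a2 else a1)), (fun=> - y); split.
  by move=> _; case: c; [right|left]; exists t.
by apply/funext => x; rewrite big_ord1 mul1r dotvZ opprK.
Qed.

Variable X : set 'rV[R]_d.
Hypothesis cX : compact X.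
Hypothesis sigma_npoly : ~ exists q : {poly R}, forall x, sigma x = q.[x].

(** The profiles [u] for which [P] and [Q] agree on [u (a . x)] form a linear class closed under
    uniform limits on [[- r, r]], where [r] bounds [a . x] on [X]; it contains every
    [sigma (t * x + y)], hence the ramps. *)
Lemma ridge_functionals_ramp (P Q : ('rV[R]_d -> R) -> R) :
  positive_functional X P -> positive_functional X Q -> (forall s, S s -> P s = Q s) ->
  forall c a k, P (fun x => ramp a k (direction a1 a2 c x)) =
                Q (fun x => ramp a k (direction a1 a2 c x)).
Proof.
move=> pP pQ PQ c a k.
have cpr := @direction_continuous _ _ a1 a2 c.
have [r r0 Xr] := compact_bounded cX cpr.
have ccomp (u : R -> R) : continuous u -> continuous (fun x => u (direction a1 a2 c x)).
  by move=> cu x; apply: continuous_comp; [exact: cpr|exact: cu].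
pose V : set (R -> R) := [set u | continuous u /\
  P (fun x => u (direction a1 a2 c x)) = Q (fun x => u (direction a1 a2 c x))].
have [PD PZ P0] := pP; have [QD QZ Q0] := pQ.
suff : V (ramp a k) by case.
apply: (@class_ramp R r V (ltW r0) _ _ _ _ sigma) => //.
- move=> u v [cu uE] [cv vE]; split.
    by move=> x; apply: cvgD; [exact: cu|exact: cv].
  by rewrite PD ?QD ?uE ?vE//; exact: ccomp.
- move=> b u [cu uE]; split.
    by move=> x; apply: cvgM; [exact: cvg_cst|exact: cu].
  by rewrite PZ ?QZ ?uE//; exact: ccomp.
- split; first by move=> x; exact: cvg_cst.
  exact: PQ ridge_span0.
- move=> u cu Vu; split => //.
  apply/eqP; rewrite -subr_eq0 -normr_eq0 eq_le normr_ge0 andbT.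
  apply/ler_addgt0Pr => e e0; rewrite add0r.
  have P1 := functional1_ge0 P0; have Q1 := functional1_ge0 Q0.
  have K0 : 0 < P (fun=> 1) + Q (fun=> 1) + 1 by rewrite ltr_wpDl// addr_ge0.
  have [v [cv vE] uv] := Vu _ (divr_gt0 e0 K0).
  have uvX x : X x -> `|u (direction a1 a2 c x) - v (direction a1 a2 c x)| <=
      e / (P (fun=> 1) + Q (fun=> 1) + 1) by move=> /Xr; exact: uv.
  have dP := functional_dist pP (ccomp u cu) (ccomp v cv) uvX.
  have dQ := functional_dist pQ (ccomp u cu) (ccomp v cv) uvX.
  rewrite -(subrKA (P (fun x => v (direction a1 a2 c x)))) (le_trans (ler_normD _ _))//.
  rewrite [in X in _ + X]vE [X in _ + X]distrC (le_trans (lerD dP dQ))// -mulrDr.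
  by rewrite mulrAC ler_pdivrMr// ler_pM2l// lerDl.
- move=> t y; split; last by apply: PQ; exact: ridge_span_direction.
  move=> x; apply: (@continuous_comp _ _ _ (fun x => t * x + y)); last exact: csigma.
  apply: cvgD; last exact: cvg_cst.
  by apply: cvgM; [exact: cvg_cst|exact: cvg_id].
Qed.

Lemma ridge_span_dense : (forall x, X x -> closed (path_orbit a1 a2 X x)) ->
  ~ has_closed_path a1 a2 X -> forall f : 'rV[R]_d -> R, continuous f ->
  forall e, 0 < e -> exists2 s, S s & forall x, X x -> `|f x - s x| < e.
Proof.
move=> cO ncp f cf e e0; apply: contrapT => H.
have fS s : S s -> exists2 x, X x & e <= `|f x - s x|.
  move=> Ss; apply: contrapT => Hs; apply: H; exists s => // x Xx.
  by rewrite ltNge; apply/negP => ex; apply: Hs; exists x.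
have [P [Q [pP pQ PQ]]] := separating_functionals cX ridge_span_continuous
  ridge_spanD ridge_spanZ ridge_span0 cf e0 fS.
rewrite (functional_eq cX (@direction_continuous _ _ a1 a2) (acyclic_directions ncp)
  (orbit_attained cX cO) pP pQ (ridge_functionals_ramp pP pQ PQ) cf).
by rewrite ltxx.
Qed.

(** The product of the distances to the other points of the cycle vanishes at all of them except
    [a 0], so its alternating sum is [f (a 0) > 0]. An [s] closer than [f (a 0) / (2n)] at all [2n]
    points would make that sum smaller. *)
Lemma ridge_span_closed_path : has_closed_path a1 a2 X ->
  exists2 f : 'rV[R]_d -> R, continuous f &
    exists2 e, 0 < e & forall s, S s -> exists2 x, X x & e <= `|f x - s x|.
Proof.
move=> [n0 [p0 /closed_path_alternating_cycle[q]]].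
move=> /alternating_cycle_annihilator[n [a [ngt0 Xa aneq asum]]].
pose g (l : nat) (x : 'rV[R]_d) : R := if l == 0%N then 1 else `|x - a l|.
pose f (x : 'rV[R]_d) := \prod_(l < n.*2) g l x.
have cf : continuous f.
  have cg l : continuous (g l).
    rewrite /g; case: eqP => _ x; first exact: cst_continuous.
    exact: norm_sub_continuous.
  rewrite /f; elim: (index_enum _) => [|i s IH].
    rewrite (_ : (fun x => _) = fun=> 1); first exact: cst_continuous.
    by apply/funext => x; rewrite big_nil.
  rewrite (_ : (fun x => _) = fun x => g i x * \prod_(l <- s) g l x).
    by move=> x; apply: continuousM; [exact: cg|exact: IH].
  by apply/funext => x; rewrite big_cons.
have fa0 : 0 < f (a 0%N).
  apply: prodr_gt0 => l _; rewrite /g; case: eqP => // /eqP l0.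
  rewrite normr_gt0 subr_eq0 eq_sym; apply/eqP; apply: aneq.
  by rewrite lt0n l0 ltn_ord.
have fal (l : 'I_n.*2) : l != 0%N :> nat -> f (a l) = 0.
  by move=> /negbTE l0; rewrite /f (bigD1 l)//= {1}/g l0 subrr normr0 mul0r.
have n2 : (0 < n.*2)%N by rewrite double_gt0.
have n2R : 0 < n.*2%:R :> R by rewrite ltr0n.
have fsum : \sum_(l < n.*2) (-1) ^+ l * f (a l) = f (a 0%N).
  rewrite (bigD1 (Ordinal n2))//= expr0 mul1r big1 ?addr0// => l l0.
  by rewrite fal ?mulr0//; apply: contra_neq l0 => l0; exact: val_inj.
exists f => //; exists (f (a 0%N) / n.*2%:R); first by rewrite divr_gt0.
move=> s [m [c [w [th [Ww sE]]]]]; apply: contrapT => Hs.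
have sX l : `|f (a l) - s (a l)| < f (a 0%N) / n.*2%:R.
  by rewrite ltNge; apply/negP => ex; apply: Hs; exists (a l).
have ssum : \sum_(l < n.*2) (-1) ^+ l * s (a l) = 0.
  rewrite sE; under eq_bigr do rewrite mulr_sumr.
  rewrite exchange_big/= big1// => k _.
  have [b [t wE]] := two_linesP (Ww k).
  rewrite -[RHS](asum (fun y => c k * sigma (t * y - th k)) b).
  by apply: eq_bigr => l _; rewrite wE.
have : `|\sum_(l < n.*2) (-1) ^+ l * (f (a l) - s (a l))| < f (a 0%N).
  rewrite (le_lt_trans (ler_norm_sum _ _ _))//.
  rewrite (@lt_le_trans _ _ (\sum_(l < n.*2) f (a 0%N) / n.*2%:R))//.
    apply: ltr_sum.
      by apply/hasP; exists (Ordinal n2) => //; rewrite mem_index_enum.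
    by move=> l _; rewrite normrM normrX normrN1 expr1n mul1r.
  by rewrite sumr_const card_ord -(mulr_natr (f (a 0%N) / _)) divfK// gt_eqF.
under eq_bigr do rewrite mulrBr.
by rewrite sumrB ssum subr0 fsum gtr0_norm// ltxx.
Qed.

End RidgeFunctions.

Lemma closure_uniformP (R : realType) (d : nat) (X : set 'rV[R]_d)
    (A : set {uniform` X -> R}) (f : 'rV[R]_d -> R) :
  closure A (f : {uniform` X -> R}) <->
  forall e, 0 < e -> exists2 g : 'rV[R]_d -> R, A g & forall x, X x -> `|f x - g x| < e.
Proof.
split=> [Af e e0|H B /uniform_nbhs[E []]].
  have [|g [Ag fg]] := Af [set g : 'rV[R]_d -> R | forall x, X x -> `|f x - g x| < e].
    apply/uniform_nbhs; exists [set xy | ball xy.1 e xy.2]; split.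
      by rewrite -entourage_ballE; exists e.
    by move=> g /= Hg x /Hg; rewrite -ball_normE.
  by exists g.
rewrite -entourage_ballE => -[e /= e0 eE] EB.
have [g Ag fg] := H e e0; exists g; split => //; apply: EB => x Xx; apply: eE.
by rewrite /= -ball_normE; exact: fg.
Qed.

Theorem theorem5p5 (R : realType) (d : nat) (sigma : R -> R)
    (a1 a2 : 'rV[R]_d) (X : set 'rV[R]_d)
    (sigma_cont : continuous sigma)
    (sigma_npoly : ~ exists q : {poly R}, forall x, sigma x = q.[x])
    (a1_neq0 : a1 != 0) (a2_neq0 : a2 != 0)
    (X_compact : compact X)
    (orbits_closed : forall x, X x -> closed (path_orbit a1 a2 X x)) :
  dense_in (MX sigma (two_lines a1 a2) X) (CX X) <->
  ~ has_closed_path a1 a2 X.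
Proof.
split=> [[_ dense] /(@ridge_span_closed_path _ _ sigma)[f cf [e e0 fS]]|ncp].
  have /closure_uniformP /(_ e e0)[g [h Sh gh] fg] : closure (MX sigma (two_lines a1 a2) X) f.
    by apply: dense; exact: continuous_subspaceT.
  have [x Xx] := fS h Sh.
  by rewrite -gh// leNgt fg.
have cX : closed X by apply: compact_closed => //; exact: norm_hausdorff.
split=> [g [h Sh gh]|f cf].
  have ch : {within X, continuous h}.
    by apply: continuous_subspaceT; exact: ridge_span_continuous Sh.
  apply: subspace_eq_continuous ch => x; rewrite inE => Xx; exact/esym/gh.
apply/closure_uniformP => e e0.
have [M M0 fM] : exists2 M, 0 < M & forall x, X x -> `|f x| <= M.
  have [X0|/set0P X0] := eqVneq X set0; first by exists 1 => // x; rewrite X0.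
  have cn : {within X, continuous (fun x => `|f x|)}.
    by move=> x; apply: cvg_norm; exact: cf.
  have [c _ cm] := compact_EVT_max X0 X_compact cn.
  exists (`|f c| + 1) => [|x Xx]; first by rewrite ltr_wpDl.
  by rewrite (le_trans (cm x _))// ?inE// lerDl.
(* [f] is continuous only within [X]; Tietze's theorem gives a globally continuous function with the
   same values on [X]. *)
have [F [fF cF _]] := continuous_bounded_extension pseudometric_normal cX M0 cf fM.
have [s Ss Fs] := ridge_span_dense sigma_cont X_compact sigma_npoly orbits_closed ncp cF e0.
by exists s => [|x Xx]; [exists s|rewrite fF ?inE//; exact: Fs].
Qed.
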